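(* Let $\bar M^{n+1}$ be a Riemannian manifold admitting a non-null closed conformal vector field $X$, and let $M$ be an orientable hypersurface of $\bar M$ with unit normal vector field $\xi$, such that the angle $\theta$ between $X$ and $\xi$ takes values in $(0,\pi)$ along $M$. Let $X^T$ be the component of $X$ tangent to $M$ and $T=X^T/|X^T|$. Then the following statements are equivalent: (1) $M$ has a canonical principal direction relative to $X$, i.e., $T$ is a principal direction of $M$ at every point. (2) The angle $\theta$ is constant along the directions tangent to $M$ and orthogonal to $T$, i.e., $Z(\theta)=0$ for every vector field $Z$ tangent to $M$ with $\langle Z,T\rangle=0$. In addition, consider an open subset of $\bar M$ isometric to a warped product $I\times_\varrho N$ with $X=\varrho\,\partial_t$, suppose that $\theta\neq\pi/2$ everywhere on $M$, and that $M$ is given there as the graph $M=\{(F(x),x) : x\in U\}$ of a function $F:U\to I$ with $U\subseteq N$ open; let $h:M\to\mathbb R$ be the height function of $M$. Then (1) and (2) are also equivalent to each of the following: (3) The integral curves of $T$ are geodesics in $M$. (4) The norm $|\nabla h|$ of the gradient of $h$ is constant along the level curves of $h$. (5) The norm $|\nabla F|$ of the gradient of $F$ is constant along the level curves of $F$.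
   Context: All objects are smooth. A vector field $X$ on a Riemannian manifold $\bar M$ with Levi-Civita connection $\bar\nabla$ is closed conformal if there is a differentiable function $\phi$ on $\bar M$ such that $\bar\nabla_Y X=\phi Y$ for every vector field $Y$ on $\bar M$. The angle $\theta$ is defined by $\cos\theta=\langle X/|X|,\xi\rangle$; the condition $\theta\in(0,\pi)$ (in particular $X\neq 0$ along $M$) means that $X^T=X-\langle X,\xi\rangle\xi$ is nowhere zero on $M$. A principal direction is an eigendirection of the shape operator $A_\xi$, where $A_\xi Y=-\bar\nabla_Y\xi$. For an interval $I\subset\mathbb R$, a Riemannian $n$-manifold $N$ with metric $g_N$ and a positive function $\varrho$ on $I$, the warped product $I\times_\varrho N$ is $I\times N$ with the metric $dt^2+\varrho(t)^2 g_N$, and $\partial_t$ is the lift of the standard unit vector field on $I$. (Away from its zeros, any non-null closed conformal field $X$ locally gives such a warped product structure with $X=\varrho\,\partial_t$.) The height function $h$ is the restriction to $M$ of the projection $I\times_\varrho N\to I$, so $h(F(x),x)=F(x)$. The gradient $\nabla h$ is taken on $M$ with its induced metric, and $\nabla F$ is taken on $U\subseteq N$ with the metric $g_N$. The ''level curves'' of $h$ (of $F$) are the connected components of its level sets; thus being constant along the level curves means having zero derivative in all directions tangent to the level sets. *)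

(* Defs.v *)
From mathcomp Require Import all_boot all_order all_algebra.
From mathcomp Require Import all_classical all_reals all_analysis.

Set Implicit Arguments.
Unset Strict Implicit.
Unset Printing Implicit Defensive.

Import Order.TTheory GRing.Theory Num.Theory.
Import numFieldNormedType.Exports.

Local Open Scope classical_set_scope.
Local Open Scope ring_scope.

Fixpoint Ck (R : realType) (V W : normedModType R) (k : nat) (U : set V)
    (f : V -> W) : Prop :=
  match k with
  | 0%N => forall x, U x -> {for x, continuous f}
  | k'.+1 => (forall x, U x -> differentiable f x) /\
             (forall v, Ck k' U (fun x => 'D_v f x))
  end.

(* Meant for open U: only the germs of f at the points of U matter. *)
Definition smooth_on (R : realType) (V W : normedModType R) (U : set V)
    (f : V -> W) : Prop := forall k, Ck k U f.

(* A family of charts, without axioms: the chart a is the partial map [coord a]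
   from [dom a] onto an open subset of R^n, with inverse [coordV a]; both are
   total functions whose values elsewhere are irrelevant. *)
Record atlas (R : realType) (n : nat) := Atlas {
  carrier :> topologicalType;
  chart : Type;
  dom : chart -> set carrier;
  coord : chart -> carrier -> 'rV[R]_n;
  coordV : chart -> 'rV[R]_n -> carrier }.

Definition rep (R : realType) (m n : nat) (M : atlas R m) (N : atlas R n)
    (f : M -> N) (a : chart M) (b : chart N) : 'rV[R]_m -> 'rV[R]_n :=
  coord b \o f \o coordV a.

Definition smooth_map (R : realType) (m n : nat) (M : atlas R m)
    (N : atlas R n) (A : set M) (f : M -> N) : Prop :=
  (forall p, A p -> {for p, continuous f}) /\
  (forall a b, smooth_on (coord a @` (A `&` dom a `&` f @^-1` dom b))
                         (rep f a b)).

Definition smooth_fun (R : realType) (m : nat) (M : atlas R m) (A : set M)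
    (f : M -> R) : Prop :=
  forall a, smooth_on (coord a @` (A `&` dom a)) (f \o coordV a).

Definition is_manifold (R : realType) (n : nat) (M : atlas R n) : Prop :=
  [/\ hausdorff_space M, @second_countable M,
      (forall p : M, exists a, dom a p),
      (forall a : chart M,
        [/\ open (dom a), open (coord a @` dom a),
            (forall p, dom a p -> coordV a (coord a p) = p),
            (forall p, dom a p -> {for p, continuous (coord a)}) &
            (forall p, dom a p -> {for coord a p, continuous (coordV a)})]) &
      (forall a b : chart M,
        smooth_on (coord a @` (dom a `&` dom b)) (coord b \o coordV a))].

(* Components in the chart b of df_p(v), for v given by its components in the
   chart a; with f the identity, the change of components from a to b. *)
Definition dmap (R : realType) (m n : nat) (M : atlas R m) (N : atlas R n)
    (f : M -> N) (a : chart M) (b : chart N) (p : M) (v : 'rV[R]_m) :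
    'rV[R]_n :=
  'D_v (rep f a b) (coord a p).

Definition dfun (R : realType) (m : nat) (M : atlas R m) (f : M -> R)
    (a : chart M) (p : M) (v : 'rV[R]_m) : R :=
  'D_v (f \o coordV a) (coord a p).

(* [V b p] : components in the chart b, which must contain f p, of a tangent
   vector to N at f p. *)
Definition field_along (R : realType) (m n : nat) (M : atlas R m)
    (N : atlas R n) (f : M -> N) := chart N -> M -> 'rV[R]_n.

Definition is_field_along (R : realType) (m n : nat) (M : atlas R m)
    (N : atlas R n) (f : M -> N) (V : field_along f) : Prop :=
  (forall b c p, dom b (f p) -> dom c (f p) ->
     V c p = dmap (@idfun N) b c (f p) (V b p)) /\
  (forall a b, smooth_on (coord a @` (dom a `&` f @^-1` dom b))
                         (V b \o coordV a)).

Arguments is_field_along {R m n M N} f V.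

Definition vfield (R : realType) (n : nat) (M : atlas R n) :=
  field_along (@idfun M).

Definition is_vfield (R : realType) (n : nat) (M : atlas R n) (X : vfield M) :=
  is_field_along (@idfun M) X.

Definition metric (R : realType) (n : nat) (M : atlas R n) :=
  chart M -> M -> 'M[R]_n.

Definition ip (R : realType) (n : nat) (M : atlas R n) (g : metric M)
    (a : chart M) (p : M) (v w : 'rV[R]_n) : R :=
  (v *m g a p *m w^T) 0 0.

Definition mnorm (R : realType) (n : nat) (M : atlas R n) (g : metric M)
    (a : chart M) (p : M) (v : 'rV[R]_n) : R := Num.sqrt (ip g a p v v).

Definition is_metric (R : realType) (n : nat) (M : atlas R n) (g : metric M) :
    Prop :=
  [/\ (forall a p, dom a p -> (g a p)^T = g a p),
      (forall a p v, dom a p -> v != 0 -> 0 < ip g a p v v),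
      (forall a b p v w, dom a p -> dom b p ->
         ip g a p v w =
         ip g b p (dmap (@idfun M) a b p v) (dmap (@idfun M) a b p w)) &
      (forall a, smooth_on (coord a @` dom a) (g a \o coordV a))].

Definition preserves_metric (R : realType) (m n : nat) (M : atlas R m)
    (N : atlas R n) (gM : metric M) (gN : metric N) (A : set M) (f : M -> N) :
    Prop :=
  forall a b p v w, A p -> dom a p -> dom b (f p) ->
    ip gM a p v w = ip gN b (f p) (dmap f a b p v) (dmap f a b p w).

(* Since the metric of M is positive definite, df is then injective, and the
   metric of M is the one induced by f. *)
Definition isometric_immersion (R : realType) (m n : nat) (M : atlas R m)
    (N : atlas R n) (gM : metric M) (gN : metric N) (f : M -> N) : Prop :=
  smooth_map setT f /\ preserves_metric gM gN setT f.

(* f, with inverse f', is an isometry from the open set A onto the open set W. *)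
Definition open_isometry (R : realType) (m n : nat) (M : atlas R m)
    (N : atlas R n) (gM : metric M) (gN : metric N) (A : set M) (W : set N)
    (f : M -> N) (f' : N -> M) : Prop :=
  [/\ open A, open W,
      (forall p, A p -> W (f p) /\ f' (f p) = p),
      (forall q, W q -> A (f' q) /\ f (f' q) = q) &
      [/\ smooth_map A f, smooth_map W f' & preserves_metric gM gN A f]].

Definition grad (R : realType) (n : nat) (M : atlas R n) (g : metric M)
    (f : M -> R) (a : chart M) (p : M) : 'rV[R]_n :=
  (\row_i dfun f a p (delta_mx 0 i)) *m invmx (g a p).

Definition grad_norm (R : realType) (n : nat) (M : atlas R n) (g : metric M)
    (f : M -> R) (a : chart M) (p : M) : R := mnorm g a p (grad g f a p).

(* [D a p u w] : components in the chart a of the covariant derivative at p, in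
   the direction u, of the field whose components in the chart a are constantly
   w; i.e. sum_(i, j) Gamma^k_ij u_i w_j in terms of Christoffel symbols. *)
Definition connection (R : realType) (n : nat) (M : atlas R n) :=
  chart M -> M -> 'rV[R]_n -> 'rV[R]_n -> 'rV[R]_n.

(* The third clause is the transformation law of Christoffel symbols. *)
Definition is_connection (R : realType) (n : nat) (M : atlas R n)
    (D : connection M) : Prop :=
  [/\ (forall a p c u v w, dom a p ->
         D a p (c *: u + v) w = c *: D a p u w + D a p v w),
      (forall a p c u v w, dom a p ->
         D a p u (c *: v + w) = c *: D a p u v + D a p u w),
      (forall a b p u w, dom a p -> dom b p ->
         'D_u (fun x => 'D_w (coord b \o coordV a) x) (coord a p) +
         D b p (dmap (@idfun M) a b p u) (dmap (@idfun M) a b p w) =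
         dmap (@idfun M) a b p (D a p u w)) &
      (forall a u w,
         smooth_on (coord a @` dom a) (fun x => D a (coordV a x) u w))].

(* Vanishing torsion and compatibility with the metric, both tested on fields
   with constant components in a chart; such fields commute. *)
Definition levi_civita (R : realType) (n : nat) (M : atlas R n) (g : metric M)
    (D : connection M) : Prop :=
  [/\ is_connection D,
      (forall a p u v, dom a p -> D a p u v = D a p v u) &
      (forall a p u v w, dom a p ->
         'D_u (fun x => ip g a (coordV a x) v w) (coord a p) =
         ip g a p (D a p u v) w + ip g a p v (D a p u w))].

(* Components in the chart b of the covariant derivative at p, in the direction
   of the vector with components v in the chart a, of a field V along f. *)
Definition covD (R : realType) (m n : nat) (M : atlas R m) (N : atlas R n)
    (D : connection N) (f : M -> N) (V : field_along f) (a : chart M)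
    (b : chart N) (p : M) (v : 'rV[R]_m) : 'rV[R]_n :=
  'D_v (V b \o coordV a) (coord a p) + D b (f p) (dmap f a b p v) (V b p).

Arguments covD {R m n M N} D f V a b p v.

Definition closed_conformal (R : realType) (n : nat) (M : atlas R n)
    (D : connection M) (X : vfield M) : Prop :=
  exists phi : M -> R, smooth_fun setT phi /\
    forall a p v, dom a p -> covD D idfun X a a p v = phi p *: v.

Definition velocity (R : realType) (n : nat) (M : atlas R n) (c : R -> M)
    (a : chart M) (t : R) : 'rV[R]_n := derive1 (coord a \o c) t.

Definition integral_curve (R : realType) (n : nat) (M : atlas R n)
    (X : vfield M) (J : set R) (c : R -> M) : Prop :=
  forall t, J t -> {for t, continuous c} /\
    forall a, dom a (c t) ->
      derivable (coord a \o c) t 1 /\ velocity c a t = X a (c t).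

Definition geodesic (R : realType) (n : nat) (M : atlas R n)
    (D : connection M) (J : set R) (c : R -> M) : Prop :=
  forall t, J t -> {for t, continuous c} /\
    forall a, dom a (c t) ->
      [/\ derivable (coord a \o c) t 1, derivable (velocity c a) t 1 &
          derive1 (velocity c a) t +
          D a (c t) (velocity c a t) (velocity c a t) = 0].

Definition unit_normal (R : realType) (m n : nat) (M : atlas R m)
    (N : atlas R n) (g : metric N) (f : M -> N) (xi : field_along f) : Prop :=
  is_field_along f xi /\
  (forall a b p, dom a p -> dom b (f p) ->
     ip g b (f p) (xi b p) (xi b p) = 1 /\
     (forall v, ip g b (f p) (dmap f a b p v) (xi b p) = 0)).

Arguments unit_normal {R m n M N} g f xi.

(* X^T = X - <X, xi> xi, as a tangent vector to the ambient manifold. *)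
Definition tangential (R : realType) (m n : nat) (M : atlas R m)
    (N : atlas R n) (g : metric N) (f : M -> N) (xi : field_along f)
    (X : vfield N) (b : chart N) (p : M) : 'rV[R]_n :=
  X b (f p) - ip g b (f p) (X b (f p)) (xi b p) *: xi b p.

Arguments tangential {R m n M N} g f xi X b p.

(* T = X^T / |X^T|, as a vector field on M. *)
Definition unit_tangential (R : realType) (m n : nat) (M : atlas R m)
    (N : atlas R n) (g : metric N) (f : M -> N) (xi : field_along f)
    (X : vfield N) (T : vfield M) : Prop :=
  is_vfield T /\
  (forall a b p, dom a p -> dom b (f p) ->
     dmap f a b p (T a p) =
     (mnorm g b (f p) (tangential g f xi X b p))^-1 *: tangential g f xi X b p).

Arguments unit_tangential {R m n M N} g f xi X T.

(* The angle between X and xi: in ]0, pi[, and in particular X does not vanish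
   along f. *)
Definition angle_in_0pi (R : realType) (m n : nat) (M : atlas R m)
    (N : atlas R n) (g : metric N) (f : M -> N) (xi : field_along f)
    (X : vfield N) (theta : M -> R) : Prop :=
  forall b p, dom b (f p) ->
    [/\ X b (f p) != 0, 0 < theta p, theta p < pi &
        cos (theta p) =
        ip g b (f p) ((mnorm g b (f p) (X b (f p)))^-1 *: X b (f p)) (xi b p)].

Arguments angle_in_0pi {R m n M N} g f xi X theta.

(* The shape operator v |-> - D_v xi of f, as a tangent vector to the ambient
   manifold. *)
Definition shape (R : realType) (m n : nat) (M : atlas R m)
    (N : atlas R n) (D : connection N) (f : M -> N) (xi : field_along f)
    (a : chart M) (b : chart N) (p : M) (v : 'rV[R]_m) : 'rV[R]_n :=
  - covD D f xi a b p v.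

Arguments shape {R m n M N} D f xi a b p v.

(* An equality of tangent vectors is tested in each pair of charts around p and
   f p. *)
Definition principal_direction (R : realType) (m n : nat) (M : atlas R m)
    (N : atlas R n) (D : connection N) (f : M -> N) (xi : field_along f)
    (T : vfield M) : Prop :=
  forall a b p, dom a p -> dom b (f p) ->
    exists lambda : R,
      shape D f xi a b p (T a p) = lambda *: dmap f a b p (T a p).

Arguments principal_direction {R m n M N} D f xi T.

(* Z(theta) = 0 only depends on the values of Z, so tangent vectors are used in
   place of vector fields. *)
Definition angle_constant_orthogonally (R : realType) (m : nat)
    (M : atlas R m) (g : metric M) (T : vfield M) (theta : M -> R) : Prop :=
  forall a p v, dom a p -> ip g a p v (T a p) = 0 -> dfun theta a p v = 0.

Definition integral_curves_geodesic (R : realType) (m : nat)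
    (M : atlas R m) (D : connection M) (T : vfield M) : Prop :=
  forall (J : set R) (c : R -> M), open J -> is_interval J ->
    integral_curve T J c -> geodesic D J c.

(* |grad f| has zero derivative in the directions tangent to the level sets of
   f, on the set A. *)
Definition grad_norm_constant_on_levels (R : realType) (m : nat)
    (M : atlas R m) (g : metric M) (A : set M) (f : M -> R) : Prop :=
  forall a p v, A p -> dom a p -> dfun f a p v = 0 ->
    dfun (grad_norm g f a) a p v = 0.

Definition cylinder (R : realType) (n : nat) (N : atlas R n) :
    atlas R (1 + n) :=
  @Atlas R (1 + n) (R * N)%type (chart N)
    (fun b => setT `*` dom b)
    (fun b q => row_mx (q.1%:M : 'M[R]_1) (coord b q.2))
    (fun b u => ((lsubmx u : 'M[R]_1) 0 0, coordV b (rsubmx u))).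

(* dt^2 + rho(t)^2 gN on R * N; a Riemannian metric over the set where rho > 0. *)
Definition warped_metric (R : realType) (n : nat) (N : atlas R n)
    (gN : metric N) (rho : R -> R) : metric (cylinder N) :=
  fun b q => block_mx (1%:M : 'M[R]_1) 0 0 ((rho q.1) ^+ 2 *: gN b q.2).

Definition partial_t (R : realType) (n : nat) : 'rV[R]_(1 + n) :=
  row_mx (1%:M : 'M[R]_1) 0.

(* Main.v *)
Require Import Defs.
From mathcomp Require Import all_boot all_order all_algebra.
From mathcomp Require Import all_classical all_reals all_analysis.
From mathcomp Require Import ring lra.

Set Implicit Arguments.
Unset Strict Implicit.
Unset Printing Implicit Defensive.

Import Order.TTheory GRing.Theory Num.Theory.
Import numFieldNormedType.Exports.

Local Open Scope classical_set_scope.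
Local Open Scope ring_scope.

Local Notation coord := Defs.coord.
Local Notation shape := Defs.shape.

(** Everything reduces to first derivatives of the angle theta, computed in
charts.  Write A for the shape operator and phi for the conformal factor of X.

Along M one has <X, xi> = |X| cos theta.  Differentiate this in a direction v
tangent to M and orthogonal to T.  As the derivative of X is phi v, which is
orthogonal to xi and to X, it contributes neither to the left-hand side nor,
through |X|, to the right-hand side; what is left is d theta(v) = <A T, v>
([dtheta_shape]).  The vector A T is tangent to M ([covD_xi_orth]) and A is
symmetric ([covD_xi_sym]), so A T is a multiple of T exactly when d theta
vanishes on the orthogonal complement of T ([principal_iff_angle]).

In the warped product |X| = rho and dh = <X, _> / rho, whence
dh(v) = sin theta <T, v> ([dfun_height_T]): T is the direction of the gradient
of h.  Given this identity, the conditions on h and on integral curves are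
intrinsic to M, and the condition on F is compared with them.
- |grad h| = sin theta, whose differential is cos theta d theta, and
  cos theta does not vanish ([angle_iff_grad_norm_height]).
- Differentiating <T, u> sin theta = dh(u) once more, the symmetry of the second
  derivatives of h gives sin theta <D_T T, u> = cos theta d theta(u) for u
  orthogonal to T ([ip_acceleration]), and D_T T is always orthogonal to T.  So
  theta is constant orthogonally to T if and only if D_T T = 0.  As an integral
  curve of T passes through every point ([integral_curve_exists]), the latter
  says that the integral curves of T are geodesics
  ([geodesics_iff_acceleration]).
- Let pr be the projection of M to N.  The metric of M is dh^2 + rho^2 gN pulled
  back by pr, and h = F o pr; comparing gradients gives
  |grad F|^2 cos^2 theta = rho^2 sin^2 theta ([sqr_grad_norm_F]).  Along a level
  set rho(h) is constant, so |grad F| and theta are constant together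
  ([angle_iff_grad_norm_graph]).

Two tools of analysis are built on the way: the symmetry of second derivatives
in the form due to Young ([young]), which asks of the first derivatives no more
than differentiability at the point, a property that dh inherits from the formula
for it; and the existence of solutions of y' = V(y) for a locally Lipschitz V
([ode_exists]), as cluster points of Euler step functions. *)

(** * Differential calculus of matrix-valued maps *)

Lemma near_eq_differentiable (R : realType) (V W : normedModType R)
    (f g : V -> W) (x : V) :
  {near x, f =1 g} -> differentiable f x -> differentiable g x.
Proof.
move=> fg df.
have dg : g \o shift x = cst (g x) + 'd f x +o_ 0 id.
  apply/eqaddoP => e e0; have /eqaddoP /(_ e e0) fo := diff_locally df.
  have fgs : \forall h \near 0, f (h + x) = g (h + x).
    by move: fg => /=; rewrite (near_shift 0 x) subr0.
  apply: filterS2 fo fgs => h; rewrite !fctE /= => fo fgh.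
  by rewrite -(nbhs_singleton fg) -fgh.
have dE := diff_unique (diff_continuous df) dg.
by apply/diff_locallyP; rewrite dE; split=> //; exact: diff_continuous.
Qed.

Lemma add_congr (V : nmodType) (x x' y y' : V) :
  x = x' -> y = y' -> x + y = x' + y'.
Proof. by move=> -> ->. Qed.

Section mx_calculus.
Variables (R : realType) (V : normedModType R).
Implicit Types (x v : V).

Lemma differentiable_mx m n (f : V -> 'M[R]_(m, n)) x :
  (forall i j, differentiable (fun y => f y i j) x) -> differentiable f x.
Proof.
move=> df.
have -> : f = \sum_(i < m) \sum_(j < n) (fun y => f y i j *: delta_mx i j).
  apply/funext => y; rewrite [LHS]matrix_sum_delta fct_sumE.
  by apply: eq_bigr => i _; rewrite fct_sumE.
apply: differentiable_sum => i; apply: differentiable_sum => j.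
exact: differentiableZl.
Qed.

Lemma differentiable_entry m n (f : V -> 'M[R]_(m, n)) x i j :
  differentiable f x -> differentiable (fun y => f y i j) x.
Proof.
move=> df.
exact: (differentiable_comp df (differentiable_coord (f x) i j)).
Qed.

Lemma derive_entry m n (f : V -> 'M[R]_(m, n)) x v i j :
  differentiable f x -> 'D_v f x i j = 'D_v (fun y => f y i j) x.
Proof. by move=> df; rewrite derive_mx ?mxE //; exact: diff_derivable. Qed.

Lemma differentiable_mulmx m n p (f : V -> 'M[R]_(m, n))
    (g : V -> 'M[R]_(n, p)) x :
  differentiable f x -> differentiable g x ->
  differentiable (fun y => f y *m g y) x.
Proof.
move=> df dg; apply: differentiable_mx => i k.
have -> : (fun y => (f y *m g y) i k) =
          \sum_(j < n) ((fun y => f y i j) * (fun y => g y j k)).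
  by apply/funext => y; rewrite mxE fct_sumE.
by apply: differentiable_sum => j; apply: differentiableM;
  apply: differentiable_entry.
Qed.

Lemma derive_mulmx m n p (f : V -> 'M[R]_(m, n))
    (g : V -> 'M[R]_(n, p)) x v :
  differentiable f x -> differentiable g x ->
  'D_v (fun y => f y *m g y) x = 'D_v f x *m g x + f x *m 'D_v g x.
Proof.
move=> df dg; apply/matrixP => i k.
rewrite derive_entry; last exact: differentiable_mulmx.
have -> : (fun y => (f y *m g y) i k) =
          \sum_(j < n) ((fun y => f y i j) * (fun y => g y j k)).
  by apply/funext => y; rewrite mxE fct_sumE.
have dfj j : differentiable (fun y => f y i j) x by exact: differentiable_entry.
have dgj j : differentiable (fun y => g y j k) x by exact: differentiable_entry.
rewrite derive_sum; last first.
  by move=> j; apply: derivableM; apply: diff_derivable.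
rewrite !mxE -big_split /=; apply: eq_bigr => j _.
rewrite deriveM; [|exact: diff_derivable..].
rewrite (derive_entry v i j df) (derive_entry v j k dg) addrC.
by congr (_ + _); rewrite // [RHS]mulrC.
Qed.

Lemma differentiable_trmx m n (f : V -> 'M[R]_(m, n)) x :
  differentiable f x -> differentiable (fun y => (f y)^T) x.
Proof.
move=> df; apply: differentiable_mx => i j.
have -> : (fun y => (f y)^T i j) = (fun y => f y j i).
  by apply/funext => y; rewrite mxE.
exact: differentiable_entry.
Qed.

Lemma derive_trmx m n (f : V -> 'M[R]_(m, n)) x v :
  differentiable f x -> 'D_v (fun y => (f y)^T) x = ('D_v f x)^T.
Proof.
move=> df; apply/matrixP => i j.
rewrite derive_entry; last exact: differentiable_trmx.
rewrite [RHS]mxE derive_entry //; congr ('D_v _ x).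
by apply/funext => y; rewrite mxE.
Qed.

End mx_calculus.

Lemma derive_comp (R : realType) (U V W : normedModType R) (f : U -> V)
    (g : V -> W) (x v : U) :
  differentiable f x -> differentiable g (f x) ->
  'D_v (g \o f) x = 'D_('D_v f x) g (f x).
Proof.
move=> df dg; rewrite !deriveE //; last exact: differentiable_comp.
by rewrite diff_comp.
Qed.

Lemma derive_scale (R : realType) (V W : normedModType R) (f : V -> W)
    (x u : V) (c : R) :
  differentiable f x -> 'D_(c *: u) f x = c *: 'D_u f x.
Proof. by move=> df; rewrite !deriveE // linearZ. Qed.

(** * Symmetry of second derivatives *)

Lemma is_derive_line (R : realType) (V W : normedModType R) (f : V -> W)
    (u z : V) (s : R) :
  differentiable f (s *: u + z) ->
  is_derive s 1 (fun t : R => f (t *: u + z)) ('D_u f (s *: u + z)).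
Proof.
move=> df.
have dl : is_diff s (fun t : R => t *: u + z) ( *:%R ^~ u).
  have -> : (fun t : R => t *: u + z) = ( *:%R ^~ u) + cst z by [].
  have H := is_diffD (is_diff_scalel s u) (is_diff_cst z s).
  by apply: is_diff_eq H _; rewrite addr0.
have dc : differentiable (f \o (fun t : R => t *: u + z)) s.
  exact: differentiable_comp.
apply: DeriveDef; first exact: diff_derivable.
rewrite deriveE // diff_comp //= deriveE //.
by rewrite diff_val scale1r.
Qed.

(** For fixed t, the second difference is the increment over [0, t] of
s |-> f (s u + t v + x) - f (s u + x).  The mean value theorem turns it into t
times a difference of two values of D_u f near x, which the differentiability of
D_u f at x estimates up to o(t). *)
Lemma second_difference (R : realType) (V : normedModType R) (f : V -> R)
    (x u v : V) (e : R) :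
  (\forall y \near x, differentiable f y) ->
  differentiable (fun y => 'D_u f y) x -> 0 < e ->
  \forall t \near (0 : R)^'+,
    `|f (t *: u + (t *: v + x)) - f (t *: u + x) - f (t *: v + x) + f x
       - t ^+ 2 * 'D_v (fun y => 'D_u f y) x| <= e * t ^+ 2.
Proof.
move=> df dk e0; set k := fun y => 'D_u f y in dk *.
pose C := 2 * `|u| + `|v| + 1.
have C0 : 0 < C by rewrite /C ltr_wpDl // addr_ge0 // mulr_ge0.
have e'0 : 0 < e / C by rewrite divr_gt0.
have /eqaddoP /(_ _ e'0) ko := diff_locally dk.
move/nbhs_ballP : df => [r1 /= r10 df].
move/nbhs_ballP : ko => [r2 /= r20 ko].
pose r := Num.min r1 r2.
have r0 : 0 < r by rewrite lt_min r10 r20.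
near=> t.
have t0 : 0 < t by near: t; exact: nbhs_right_gt.
have tC : t * C < r.
  rewrite -ltr_pdivlMr //; near: t; apply: nbhs_right_lt.
  by rewrite divr_gt0.
have bnd (s : R) (b : bool) : 0 <= s -> s <= t ->
    `|s *: u + (t *+ b) *: v| <= t * (`|u| + b%:R * `|v|).
  move=> s0 st; apply: (le_trans (ler_normD _ _)).
  rewrite !normrZ mulrDr; apply: lerD.
    by rewrite ger0_norm // ler_wpM2r.
  case: b => /=; first by rewrite mul1r gtr0_norm ?mulr1n.
  by rewrite mulr0n mul0r normr0 mul0r mulr0.
have bnd2 (s : R) (b : bool) : 0 <= s -> s <= t ->
    `|s *: u + (t *+ b) *: v| < r.
  move=> s0 st; apply: le_lt_trans (bnd s b s0 st) _.
  apply: le_lt_trans tC; rewrite ler_wpM2l ?(ltW t0) //.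
  rewrite /C -addrA lerD //; first by rewrite ler_peMl // ler1n.
  by case: b; rewrite ?mul1r ?mul0r ?lerDl // addr_ge0.
have dfs (s : R) (b : bool) : 0 <= s -> s <= t ->
    differentiable f (s *: u + ((t *+ b) *: v + x)).
  move=> s0 st; apply: df; rewrite -ball_normE /ball_ /=.
  rewrite addrA opprD addrCA subrr addr0 normrN.
  by apply: lt_le_trans (bnd2 s b s0 st) _; rewrite ge_min lexx.
have kos (s : R) (b : bool) : 0 <= s -> s <= t ->
    `|k (s *: u + ((t *+ b) *: v + x)) - k x - 'd k x (s *: u + (t *+ b) *: v)|
      <= e / C * (t * (`|u| + b%:R * `|v|)).
  move=> s0 st.
  have B : ball 0 r2 (s *: u + (t *+ b) *: v).
    rewrite -ball_normE /ball_ /= sub0r normrN.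
    by apply: lt_le_trans (bnd2 s b s0 st) _; rewrite ge_min lexx orbT.
  have := ko _ B; rewrite !fctE /= opprD !addrA => /le_trans; apply.
  by rewrite ler_wpM2l ?bnd // ltW.
pose phi (s : R) := f (s *: u + (t *: v + x)) - f (s *: u + x).
pose dphi (s : R) := k (s *: u + (t *: v + x)) - k (s *: u + x).
have dphiP (s : R) : 0 <= s -> s <= t -> is_derive s 1 phi (dphi s).
  move=> s0 st; apply: is_deriveB; apply: is_derive_line.
    exact: (dfs s true).
  by have := dfs s false s0 st; rewrite mulr0n scale0r add0r.
have [s st phiE] : exists2 s, s \in `]0, t[%R & phi t - phi 0 = dphi s * (t - 0).
  apply: MVT => // [s|].
    by rewrite in_itv /= => /andP[/ltW s0 /ltW st]; apply: dphiP.
  apply: derivable_within_continuous => s.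
  by rewrite in_itv /= => /andP[s0 st]; case: (dphiP s s0 st).
move: st; rewrite in_itv /= => /andP[/ltW s0 /ltW st].
have -> : f (t *: u + (t *: v + x)) - f (t *: u + x) - f (t *: v + x) + f x
    = phi t - phi 0.
  by rewrite /phi !scale0r !add0r; ring.
rewrite phiE subr0 deriveE // expr2 -mulrA (mulrC _ t) -mulrBr normrM gtr0_norm //.
rewrite mulrCA ler_wpM2l ?(ltW t0) //.
have := kos s true s0 st; have := kos s false s0 st.
rewrite mulr1n mulr0n !scale0r !addr0 !add0r mul1r mul0r addr0.
set A := k (s *: u + (t *: v + x)) - _; set B := k _ - _.
have -> : 'd k x (s *: u) = s * 'd k x u by rewrite linearZ.
have -> : 'd k x (s *: u + t *: v) = s * 'd k x u + t * 'd k x v.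
  by rewrite linearD !linearZ.
move=> K0 K1.
rewrite -/k; have -> : dphi s - t * 'd k x v =
    (A - (s * 'd k x u + t * 'd k x v)) - (B - s * 'd k x u).
  by rewrite /dphi /A /B /=; ring.
apply: (le_trans (ler_normB _ _)).
apply: (le_trans (lerD K1 K0)).
set LHS := (X in X <= _).
have -> : LHS = e * t * ((2 * `|u| + `|v|) / C) by rewrite /LHS; ring.
rewrite ler_piMr ?mulr_ge0 ?(ltW t0) ?(ltW e0) // ler_pdivrMr // mul1r /C; lra.
Unshelve. all: by end_near. Qed.

(** The second difference of f is symmetric in u and v, while
[second_difference], used in both orders, makes it equivalent to t^2 times either
mixed derivative. *)
Lemma young (R : realType) (V : normedModType R) (f : V -> R) (x u v : V) :
  (\forall y \near x, differentiable f y) ->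
  differentiable (fun y => 'D_u f y) x -> differentiable (fun y => 'D_v f y) x ->
  'D_v (fun y => 'D_u f y) x = 'D_u (fun y => 'D_v f y) x.
Proof.
move=> df du dv; apply/eqP; rewrite -subr_eq0 -normr_le0.
apply/ler_addgt0Pl => e e0; rewrite addr0.
have e20 : 0 < e / 2 by rewrite divr_gt0.
have S1 := second_difference v df du e20.
have S2 := second_difference u df dv e20.
have [t [t0 [H1 H2]]] := filter_ex (filterI (nbhs_right_gt 0) (filterI S1 S2)).
rewrite -(@ler_pM2r _ (t ^+ 2)) ?exprn_gt0 //.
rewrite -[X in _ * X <= _]ger0_norm ?exprn_ge0 ?(ltW t0) // -normrM.
move: H1 H2; rewrite (addrCA (t *: v)); set a := f (t *: u + _).
set b := f _; set c := f _; set d := f x; set A := 'D_v _ _; set B := 'D_u _ _.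
move=> H1 H2.
have -> : (A - B) * t ^+ 2 = (a - c - b + d - t ^+ 2 * B) - (a - b - c + d - t ^+ 2 * A).
  by ring.
apply: (le_trans (ler_normB _ _)); apply: (le_trans (lerD H2 H1)).
by rewrite -mulrDl -splitr.
Qed.

Lemma young_mx (R : realType) (V : normedModType R) m n (f : V -> 'M[R]_(m, n))
    (x u v : V) :
  (\forall y \near x, differentiable f y) ->
  differentiable (fun y => 'D_u f y) x -> differentiable (fun y => 'D_v f y) x ->
  'D_v (fun y => 'D_u f y) x = 'D_u (fun y => 'D_v f y) x.
Proof.
move=> df du dv; apply/matrixP => i j.
have E1 := derive_entry v i j du.
have E2 := derive_entry u i j dv.
apply: etrans E1 _; apply: etrans (esym E2).
have E w : \forall y \near x, 'D_w f y i j = 'D_w (fun z => f z i j) y.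
  by apply: filterS df => y dfy; exact: derive_entry.
apply: etrans (near_eq_derive v (E u)) _.
apply: etrans _ (esym (near_eq_derive u (E v))); apply: young.
- by apply: filterS df => y; exact: differentiable_entry.
- by apply: near_eq_differentiable (E u) _; exact: differentiable_entry.
- by apply: near_eq_differentiable (E v) _; exact: differentiable_entry.
Qed.

(** * Scalar-valued maps, determinants and inverse matrices *)

Section scalar_calculus.
Variables (R : realType) (V : normedModType R).
Implicit Types (f g : V -> R) (x v : V).

Lemma differentiable_comp1 f (g : R -> R) dg x :
  differentiable f x -> is_derive (f x) 1 g dg -> differentiable (g \o f) x.
Proof.
by move=> df [/derivable1_diffP dgf _]; exact: differentiable_comp.
Qed.

Lemma derive_comp1 f (g : R -> R) dg x v :
  differentiable f x -> is_derive (f x) 1 g dg ->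
  'D_v (g \o f) x = dg * 'D_v f x.
Proof.
move=> df [/derivable1_diffP dgf gE]; rewrite derive_comp //.
rewrite -[X in 'D_X _ _ = _](mulr1 ('D_v f x)) [LHS]derive_scale // gE.
exact: mulrC.
Qed.

Lemma differentiable_sqrt f x :
  differentiable f x -> 0 < f x -> differentiable (fun y => Num.sqrt (f y)) x.
Proof. by move=> df f0; apply: (differentiable_comp1 df (is_derive1_sqrt f0)). Qed.

Lemma differentiable_big_sum (I : Type) (r : seq I) (f : I -> V -> R) x :
  (forall i, differentiable (f i) x) ->
  differentiable (fun y => \sum_(i <- r) f i y) x.
Proof.
move=> df; elim: r => [|i r IH].
  under eq_fun do rewrite big_nil; exact: differentiable_cst.
by under eq_fun do rewrite big_cons; exact: differentiableD.
Qed.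

Lemma differentiable_big_prod (I : Type) (r : seq I) (f : I -> V -> R) x :
  (forall i, differentiable (f i) x) ->
  differentiable (fun y => \prod_(i <- r) f i y) x.
Proof.
move=> df; elim: r => [|i r IH].
  under eq_fun do rewrite big_nil; exact: differentiable_cst.
by under eq_fun do rewrite big_cons; exact: differentiableM.
Qed.

Lemma differentiable_det n (A : V -> 'M[R]_n) x :
  (forall i j, differentiable (fun y => A y i j) x) ->
  differentiable (fun y => \det (A y)) x.
Proof.
move=> dA; apply: differentiable_big_sum => s.
apply: differentiableM; first exact: differentiable_cst.
by apply: differentiable_big_prod => i.
Qed.

Lemma differentiable_invmx n (A : V -> 'M[R]_n) x :
  (\forall y \near x, A y \in unitmx) -> differentiable A x ->
  differentiable (fun y => invmx (A y)) x.
Proof.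
move=> uA dA.
have dAe i j : differentiable (fun y => A y i j) x.
  exact: differentiable_entry.
suff : differentiable (fun y => (\det (A y))^-1 *: \adj (A y)) x.
  apply: near_eq_differentiable; apply: filterS uA => y uy.
  by rewrite /invmx uy.
apply: differentiable_mx => i j; under eq_fun do rewrite !mxE.
apply: differentiableM.
  apply: differentiableV; first exact: differentiable_det.
  by have := nbhs_singleton uA; rewrite unitmxE unitfE.
apply: differentiableM; first exact: differentiable_cst.
by apply: differentiable_det => k l; under eq_fun do rewrite !mxE.
Qed.

End scalar_calculus.

(** * Bilinear forms depending on a point *)

Section gram.
Variable R : realType.

Definition gram n (v : 'rV[R]_n) (G : 'M[R]_n) (w : 'rV[R]_n) : R :=
  (v *m G *m w^T) 0 0.

Lemma gramDl n (G : 'M[R]_n) v1 v2 w :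
  gram (v1 + v2) G w = gram v1 G w + gram v2 G w.
Proof. by rewrite /gram !mulmxDl mxE. Qed.

Lemma gramDr n (G : 'M[R]_n) v w1 w2 :
  gram v G (w1 + w2) = gram v G w1 + gram v G w2.
Proof. by rewrite /gram linearD /= mulmxDr mxE. Qed.

Lemma gramZl n (G : 'M[R]_n) c v w : gram (c *: v) G w = c * gram v G w.
Proof. by rewrite /gram -!scalemxAl mxE. Qed.

Lemma gramZr n (G : 'M[R]_n) c v w : gram v G (c *: w) = c * gram v G w.
Proof. by rewrite /gram linearZ /= -!scalemxAr mxE. Qed.

Lemma gram0l n (G : 'M[R]_n) w : gram 0 G w = 0.
Proof. by rewrite /gram !mul0mx mxE. Qed.

Lemma gram0r n (G : 'M[R]_n) v : gram v G 0 = 0.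
Proof. by rewrite /gram trmx0 mulmx0 mxE. Qed.

Lemma gramC n (G : 'M[R]_n) v w : G^T = G -> gram v G w = gram w G v.
Proof.
move=> sG; have -> : gram v G w = (v *m G *m w^T)^T 0 0 by rewrite mxE.
by rewrite !trmx_mul trmxK sG mulmxA.
Qed.

Variable V : normedModType R.

Lemma differentiable_gram n (v w : V -> 'rV[R]_n) (G : V -> 'M[R]_n) x :
  differentiable v x -> differentiable G x -> differentiable w x ->
  differentiable (fun y => gram (v y) (G y) (w y)) x.
Proof.
move=> dv dG dw; rewrite /gram; apply: differentiable_entry.
apply: differentiable_mulmx; first exact: differentiable_mulmx.
exact: differentiable_trmx.
Qed.

Lemma derive_gram n (v w : V -> 'rV[R]_n) (G : V -> 'M[R]_n) x u :
  differentiable v x -> differentiable G x -> differentiable w x ->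
  'D_u (fun y => gram (v y) (G y) (w y)) x =
  gram ('D_u v x) (G x) (w x) + gram (v x) ('D_u G x) (w x) +
  gram (v x) (G x) ('D_u w x).
Proof.
move=> dv dG dw; rewrite /gram.
have dm : differentiable (fun y => v y *m G y) x by exact: differentiable_mulmx.
have dt : differentiable (fun y => (w y)^T) x by exact: differentiable_trmx.
rewrite -derive_entry; last exact: differentiable_mulmx.
by rewrite derive_mulmx // derive_mulmx // derive_trmx // mulmxDl !mxE.
Qed.

End gram.

(** Compatibility of a connection with a metric is only postulated for fields with
constant components.  The product rule extends it to arbitrary fields v, w along
a map y, with 'D_u v + D (dy u) v in the role of the covariant derivative. *)
Lemma derive_gram_along (R : realType) (V : normedModType R) (k : nat)
    (y : V -> 'rV[R]_k) (G : 'rV[R]_k -> 'M[R]_k)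
    (D : 'rV[R]_k -> 'rV[R]_k -> 'rV[R]_k) (v w : V -> 'rV[R]_k) (x u : V) :
  differentiable y x -> differentiable G (y x) ->
  differentiable v x -> differentiable w x ->
  (forall a b c, 'D_a (fun z => gram b (G z) c) (y x) =
     gram (D a b) (G (y x)) c + gram b (G (y x)) (D a c)) ->
  'D_u (fun z => gram (v z) (G (y z)) (w z)) x =
  gram ('D_u v x + D ('D_u y x) (v x)) (G (y x)) (w x) +
  gram (v x) (G (y x)) ('D_u w x + D ('D_u y x) (w x)).
Proof.
move=> dy dG dv dw compat.
have dGy : differentiable (G \o y) x by exact: differentiable_comp.
rewrite (derive_gram u dv dGy dw) gramDl gramDr /=.
rewrite (derive_comp u dy dG).
have /= := compat ('D_u y x) (v x) (w x).
have dc (a : 'rV[R]_k) : differentiable (cst a) (y x) by exact: differentiable_cst.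
rewrite (derive_gram _ (dc _) dG (dc _)) !derive_cst /=.
rewrite gram0l gram0r add0r addr0 => ->.
by ring.
Qed.

(** * Charts, maps and fields along maps *)

Section ip_linear.
Variables (R : realType) (n : nat) (M : atlas R n) (g : metric M).
Implicit Types (a : chart M) (p : M) (u v w : 'rV[R]_n).

Lemma ipDl a p u v w : ip g a p (u + v) w = ip g a p u w + ip g a p v w.
Proof. exact: gramDl. Qed.

Lemma ipDr a p u v w : ip g a p w (u + v) = ip g a p w u + ip g a p w v.
Proof. exact: gramDr. Qed.

Lemma ipZl a p c u w : ip g a p (c *: u) w = c * ip g a p u w.
Proof. exact: gramZl. Qed.

Lemma ipZr a p c u w : ip g a p w (c *: u) = c * ip g a p w u.
Proof. exact: gramZr. Qed.

Lemma ipNl a p u w : ip g a p (- u) w = - ip g a p u w.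
Proof. by rewrite -scaleN1r ipZl mulN1r. Qed.

Lemma ipNr a p u w : ip g a p w (- u) = - ip g a p w u.
Proof. by rewrite -scaleN1r ipZr mulN1r. Qed.

Lemma ip0l a p w : ip g a p 0 w = 0.
Proof. exact: gram0l. Qed.

End ip_linear.

Section smooth_on.
Variables (R : realType) (V W : normedModType R) (U : set V) (f : V -> W).
Hypothesis sf : smooth_on U f.

Lemma smooth_on_differentiable x : U x -> differentiable f x.
Proof. by case: (sf 1) => + _ => /[apply]. Qed.

Lemma smooth_on_differentiable2 x v :
  U x -> differentiable (fun y => 'D_v f y) x.
Proof. by case: (sf 2) => _ /(_ v) [+ _] => /[apply]. Qed.

End smooth_on.

Section charts.
Variables (R : realType) (m : nat) (M : atlas R m).
Hypothesis M_mfd : is_manifold M.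
Implicit Types (a : chart M) (p : M).

Lemma coordK a p : dom a p -> coordV a (coord a p) = p.
Proof. by case: M_mfd => _ _ _ + _ => /(_ a)[_ _ + _ _]; exact. Qed.

Lemma chart_at p : exists a, dom a p.
Proof. by case: M_mfd. Qed.

Lemma near_dom a p : dom a p -> \forall q \near p, dom a q.
Proof.
case: M_mfd => _ _ _ + _ => /(_ a)[op _ _ _ _] ap.
exact: open_nbhs_nbhs.
Qed.

Lemma cvg_coordV a p : dom a p -> coordV a @ coord a p --> p.
Proof.
move=> ap; case: M_mfd => _ _ _ + _ => /(_ a)[_ _ _ _ /(_ _ ap)].
by rewrite /prop_for /continuous_at coordK.
Qed.

(** Passes from neighbourhoods of p to neighbourhoods of its coordinates, where
derivatives are taken. *)
Lemma near_coord a p (P : set M) : dom a p -> (\forall q \near p, P q) ->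
  \forall x \near coord a p,
    [/\ P (coordV a x), dom a (coordV a x) & coord a (coordV a x) = x].
Proof.
move=> ap nP; have cv := cvg_coordV ap.
have n1 : \forall x \near coord a p, P (coordV a x) by exact: cv.
have n2 : \forall x \near coord a p, dom a (coordV a x).
  by apply: cv; exact: near_dom.
have n3 : \forall x \near coord a p, (coord a @` dom a) x.
  apply: open_nbhs_nbhs; split; last by exists p.
  by case: M_mfd => _ _ _ + _ => /(_ a)[].
apply: filterS3 n1 n2 n3 => x Px dx [q dq qx]; split=> //.
by rewrite -qx coordK.
Qed.

Lemma rep_id_near a p : dom a p ->
  \forall x \near coord a p, rep (@idfun M) a a x = x.
Proof.
move=> ap; have := near_coord ap (near_dom ap).
by apply: filterS => x [_ _].
Qed.

Lemma differentiable_rep_id a p : dom a p ->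
  differentiable (rep (@idfun M) a a) (coord a p).
Proof.
move=> ap.
have nE : \forall x \near coord a p, id x = rep (@idfun M) a a x.
  by have := rep_id_near ap; apply: filterS => x ->.
by apply: near_eq_differentiable nE _; exact: ex_diff.
Qed.

Lemma dmap_id a p v : dom a p -> dmap (@idfun M) a a p v = v.
Proof.
move=> ap; rewrite /dmap (near_eq_derive v (rep_id_near ap)).
exact: derive_id.
Qed.

Lemma differentiable_fun (A : set M) (f : M -> R) a p : smooth_fun A f ->
  A p -> dom a p -> differentiable (f \o coordV a) (coord a p).
Proof. by move=> sf Ap ap; apply: (smooth_on_differentiable (sf a)); exists p. Qed.

End charts.

Section maps.
Variables (R : realType) (m n : nat) (M : atlas R m) (N : atlas R n).
Hypotheses (M_mfd : is_manifold M).
Variables (A : set M) (f : M -> N).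
Implicit Types (a : chart M) (b : chart N) (p : M).

Lemma differentiable_rep a b p : smooth_map A f ->
  A p -> dom a p -> dom b (f p) -> differentiable (rep f a b) (coord a p).
Proof.
by case=> _ sf Ap ap bp; apply: (smooth_on_differentiable (sf a b)); exists p.
Qed.

Lemma differentiable2_rep a b p v : smooth_map A f ->
  A p -> dom a p -> dom b (f p) ->
  differentiable (fun x => 'D_v (rep f a b) x) (coord a p).
Proof.
by case=> _ sf Ap ap bp; apply: (smooth_on_differentiable2 (sf a b)); exists p.
Qed.

Hypotheses (N_mfd : is_manifold N).

Lemma near_dom_along a b p : {for p, continuous f} -> dom a p -> dom b (f p) ->
  \forall x \near coord a p,
    [/\ dom b (f (coordV a x)), dom a (coordV a x) & coord a (coordV a x) = x].
Proof.
move=> cf ap bp.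
have nb : \forall q \near p, dom b (f q) by apply: cf; exact: (near_dom N_mfd bp).
exact: (near_coord M_mfd ap nb).
Qed.

(** The Levi-Civita connection of N pulled back by f is compatible with the metric.
The fields v, w along f are given by their components near p only: the image under
df of a field with constant components in a chart, as in [covD_xi_sym], is of this
kind. *)
Lemma derive_ip_along (g : metric N) (D : connection N) a b p
    (v w : 'rV[R]_m -> 'rV[R]_n) u :
  is_metric g -> levi_civita g D -> {for p, continuous f} ->
  differentiable (rep f a b) (coord a p) -> dom a p -> dom b (f p) ->
  differentiable v (coord a p) -> differentiable w (coord a p) ->
  'D_u (fun x => ip g b (f (coordV a x)) (v x) (w x)) (coord a p) =
  ip g b (f p) ('D_u v (coord a p) +
                D b (f p) (dmap f a b p u) (v (coord a p))) (w (coord a p)) +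
  ip g b (f p) (v (coord a p))
     ('D_u w (coord a p) + D b (f p) (dmap f a b p u) (w (coord a p))).
Proof.
move=> [_ _ _ sg] [_ _ compat] cf df ap bp dv dw.
have fpE : rep f a b (coord a p) = coord b (f p) by rewrite /rep /= coordK.
have gE : g b (f p) = (g b \o coordV b) (rep f a b (coord a p)).
  by rewrite fpE /= (coordK N_mfd bp).
have nE : \forall x \near coord a p,
    ip g b (f (coordV a x)) (v x) (w x) =
    gram (v x) ((g b \o coordV b) (rep f a b x)) (w x).
  apply: filterS (near_dom_along cf ap bp) => x [bx _ _].
  by rewrite /rep /= (coordK N_mfd bx).
rewrite (near_eq_derive _ nE) /ip gE.
apply: (derive_gram_along u df) => //.
  rewrite fpE; apply: (smooth_on_differentiable (sg b)); by exists (f p).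
move=> c d e; rewrite -gE fpE; exact: (compat b (f p) c d e bp).
Qed.

Lemma differentiable_ip_along (g : metric N) a b p
    (v w : 'rV[R]_m -> 'rV[R]_n) :
  is_metric g -> {for p, continuous f} ->
  differentiable (rep f a b) (coord a p) -> dom a p -> dom b (f p) ->
  differentiable v (coord a p) -> differentiable w (coord a p) ->
  differentiable (fun x => ip g b (f (coordV a x)) (v x) (w x)) (coord a p).
Proof.
move=> [_ _ _ sg] cf df ap bp dv dw.
have fpE : rep f a b (coord a p) = coord b (f p) by rewrite /rep /= coordK.
have nE : \forall x \near coord a p,
    gram (v x) ((g b \o coordV b) (rep f a b x)) (w x) =
    ip g b (f (coordV a x)) (v x) (w x).
  apply: filterS (near_dom_along cf ap bp) => x [bx _ _].
  by rewrite /rep /= (coordK N_mfd bx).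
apply: near_eq_differentiable nE _.
apply: differentiable_gram => //.
apply: (differentiable_comp df).
by rewrite fpE; apply: (smooth_on_differentiable (sg b)); exists (f p).
Qed.

Lemma field_comp_near (X : vfield N) a b p : {for p, continuous f} ->
  dom a p -> dom b (f p) ->
  \forall x \near coord a p, ((X b \o coordV b) \o rep f a b) x =
     X b (f (coordV a x)).
Proof.
move=> cf ap bp; apply: filterS (near_dom_along cf ap bp) => x [bx _ _] /=.
by rewrite /rep /= (coordK N_mfd bx).
Qed.

Lemma differentiable_field (X : vfield N) b q : is_vfield X -> dom b q ->
  differentiable (X b \o coordV b) (coord b q).
Proof.
by case=> _ sX bq; apply: (smooth_on_differentiable (sX b b)); exists q.
Qed.

Lemma differentiable_field_comp (X : vfield N) a b p : is_vfield X ->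
  {for p, continuous f} -> differentiable (rep f a b) (coord a p) ->
  dom a p -> dom b (f p) ->
  differentiable (fun x => X b (f (coordV a x))) (coord a p).
Proof.
move=> vX cf df ap bp; apply: near_eq_differentiable (field_comp_near X cf ap bp) _.
apply: (differentiable_comp df); rewrite /rep /= (coordK M_mfd ap).
exact: differentiable_field.
Qed.

(** The chain rule: near p, the components of X along f are those of X in the chart b
composed with f. *)
Lemma covD_field_comp (D : connection N) (X : vfield N) a b p u : is_vfield X ->
  {for p, continuous f} -> differentiable (rep f a b) (coord a p) ->
  dom a p -> dom b (f p) ->
  'D_u (fun x => X b (f (coordV a x))) (coord a p) +
    D b (f p) (dmap f a b p u) (X b (f p)) =
  covD D idfun X b b (f p) (dmap f a b p u).
Proof.
move=> vX cf df ap bp.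
have fpE : rep f a b (coord a p) = coord b (f p).
  by rewrite /rep /= (coordK M_mfd ap).
have dX : differentiable (X b \o coordV b) (rep f a b (coord a p)).
  by rewrite fpE; exact: differentiable_field.
have E1 : 'D_u (fun x => X b (f (coordV a x))) (coord a p) =
    'D_(dmap f a b p u) (X b \o coordV b) (coord b (f p)).
  apply: etrans (esym (near_eq_derive u (field_comp_near X cf ap bp))) _.
  by apply: etrans (derive_comp u df dX) _; rewrite fpE.
have E2 := congr1 (fun w => D b (f p) w (X b (f p)))
  (esym (dmap_id N_mfd (dmap f a b p u) bp)).
by rewrite /covD; apply: add_congr; [exact: E1|exact: E2].
Qed.

Lemma differentiable_field_along (V : field_along f) a b p :
  is_field_along f V -> dom a p -> dom b (f p) ->
  differentiable (V b \o coordV a) (coord a p).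
Proof.
by case=> _ sV ap bp; apply: (smooth_on_differentiable (sV a b)); exists p.
Qed.

End maps.

(** * Tangent vectors, gradients *)

Section tangent_space.
Variable R : realType.

(** A hypersurface has codimension one: the rows of J bordered by the unit normal nu
are n + 1 independent vectors, hence a basis, in which the coefficient of nu
is the product with nu. *)
Lemma orthogonal_normal_tangent n (J : 'M[R]_(n, n.+1)) (G : 'M[R]_n.+1)
    (nu w : 'rV[R]_n.+1) :
  (forall v : 'rV[R]_n, v *m J = 0 -> v = 0) -> gram nu G nu = 1 ->
  (forall v : 'rV[R]_n, gram (v *m J) G nu = 0) -> gram w G nu = 0 ->
  exists s, w = s *m J.
Proof.
move=> injJ nu1 Jnu wnu.
pose l (u : 'rV[R]_(n + 1)%N) : 'rV[R]_n := @lsubmx R 1 n 1 u.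
pose r (u : 'rV[R]_(n + 1)%N) : 'M[R]_1 := @rsubmx R 1 n 1 u.
have uE u : u = row_mx (l u) (r u) by rewrite hsubmxK.
have rE u : r u = (r u 0 0)%:M by exact: mx11_scalar.
have JnuE u : u *m col_mx J nu = l u *m J + r u 0 0 *: nu.
  by rewrite {1}(uE u) mul_row_col {1}rE mul_scalar_mx.
have free : row_free (col_mx J nu).
  apply: inj_row_free => u; rewrite JnuE => u0.
  have ru : r u 0 0 = 0.
    have := congr1 (fun z => gram z G nu) u0.
    by rewrite gramDl Jnu add0r gramZl nu1 mulr1 gram0l.
  move: u0; rewrite ru scale0r addr0 => /injJ lu.
  by rewrite (uE u) lu rE ru raddf0 row_mx0.
have full : row_full (col_mx J nu) by rewrite /row_full (eqP free) addn1.
have /submxP[u wE] := submx_full w full.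
exists (l u); move: wnu; rewrite wE JnuE gramDl Jnu add0r gramZl nu1 mulr1.
by move=> ->; rewrite scale0r addr0.
Qed.

(** The difference d of the two sides is orthogonal to t, so that <s, d> = 0 by
assumption and therefore <d, d> = 0. *)
Lemma parallel_of_orthogonal n (G : 'M[R]_n) (s t : 'rV[R]_n) :
  G^T = G -> (forall v, v != 0 -> 0 < gram v G v) -> gram t G t = 1 ->
  (forall v, gram v G t = 0 -> gram s G v = 0) -> s = gram s G t *: t.
Proof.
move=> sG pG t1 H; apply/eqP; rewrite -subr_eq0; apply/negP => /negP /pG.
set d := s - _.
have dt : gram d G t = 0.
  by rewrite /d -scaleNr gramDl gramZl t1 mulr1 subrr.
rewrite {1}/d -scaleNr gramDl gramZl (gramC t d sG) dt mulr0 addr0.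
by rewrite (H _ dt) ltxx.
Qed.

End tangent_space.

Section gradient.
Variables (R : realType) (m : nat) (M : atlas R m) (g : metric M).
Hypothesis g_metric : is_metric g.
Implicit Types (a : chart M) (p : M).

Lemma metric_unit a p : dom a p -> g a p \in unitmx.
Proof.
move=> ap; rewrite -row_free_unit; apply: inj_row_free => v v0.
case: g_metric => _ pg _ _; apply/eqP/negP => /negP /(pg a p v ap).
by rewrite /ip v0 mul0mx mxE ltxx.
Qed.

Lemma metric_sym a p : dom a p -> (g a p)^T = g a p.
Proof. by case: g_metric => sg _ _ _; exact: sg. Qed.

Lemma ipC a p u v : dom a p -> ip g a p u v = ip g a p v u.
Proof. by move=> ap; apply: gramC; exact: metric_sym. Qed.

Lemma gradE f a p w : dom a p -> (forall v, dfun f a p v = ip g a p w v) ->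
  grad g f a p = w.
Proof.
move=> ap fE; rewrite /grad.
have -> : \row_i dfun f a p (delta_mx 0 i) = w *m g a p.
  apply/rowP => i; rewrite mxE fE /ip trmx_delta -colE.
  by rewrite mxE.
by rewrite mulmxK // metric_unit.
Qed.

Lemma ip_grad f a p v : dom a p -> differentiable (f \o coordV a) (coord a p) ->
  ip g a p (grad g f a p) v = dfun f a p v.
Proof.
move=> ap df; rewrite /ip /grad mulmxKV ?metric_unit //.
rewrite mxE {2}[v]row_sum_delta /dfun deriveE // linear_sum /=.
apply: eq_bigr => i _; rewrite !mxE linearZ /= deriveE // mulrC.
by rewrite [RHS]/GRing.scale.
Qed.

End gradient.

(** * A unit field T and a function h with dh = sin theta <T, _> *)

Section unit_gradient_direction.
Variables (R : realType) (m : nat) (M : atlas R m) (g : metric M).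
Variables (D : connection M).
Hypotheses (M_mfd : is_manifold M) (g_metric : is_metric g).
Hypothesis (D_LC : levi_civita g D).
Variables (T : vfield M) (theta h : M -> R).
Hypothesis T_field : is_vfield T.
Hypothesis T1 : forall a p, dom a p -> ip g a p (T a p) (T a p) = 1.
Hypothesis theta_diff : forall a p, dom a p ->
  differentiable (theta \o coordV a) (coord a p).
Hypothesis sin0 : forall p, 0 < sin (theta p).
Hypothesis cos0 : forall p, cos (theta p) != 0.
Hypothesis h_diff : forall a p, dom a p ->
  differentiable (h \o coordV a) (coord a p).
Hypothesis dhE : forall a p v, dom a p ->
  dfun h a p v = sin (theta p) * ip g a p (T a p) v.
Implicit Types (a : chart M) (p : M).

Lemma grad_heightE a p : dom a p -> grad g h a p = sin (theta p) *: T a p.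
Proof. by move=> ap; apply: gradE => // v; rewrite dhE // ipZl. Qed.

Lemma grad_norm_heightE a p : dom a p -> grad_norm g h a p = sin (theta p).
Proof.
move=> ap; rewrite /grad_norm /mnorm grad_heightE // ipZl ipZr T1 // mulr1.
by rewrite -expr2 sqrtr_sqr ger0_norm // ltW.
Qed.

Lemma derive_grad_norm_height a p v : dom a p ->
  dfun (grad_norm g h a) a p v = cos (theta p) * dfun theta a p v.
Proof.
move=> ap.
have nE : \forall x \near coord a p,
    (grad_norm g h a \o coordV a) x = (sin \o (theta \o coordV a)) x.
  have := near_coord M_mfd ap (near_dom M_mfd ap).
  by apply: filterS => x [ax _ _] /=; rewrite grad_norm_heightE.
rewrite /dfun (near_eq_derive v nE).
rewrite (derive_comp1 v (theta_diff ap) (is_derive_sin _)) /=.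
by rewrite (coordK M_mfd ap).
Qed.

Lemma angle_iff_grad_norm_height :
  angle_constant_orthogonally g T theta <->
  grad_norm_constant_on_levels g setT h.
Proof.
split=> H a p v.
  move=> _ ap; rewrite dhE // => /eqP; rewrite mulf_eq0 gt_eqF //= => /eqP Tv.
  by rewrite derive_grad_norm_height // H ?mulr0 // (ipC g_metric).
move=> ap; rewrite (ipC g_metric) // => Tv.
have := H a p v I ap; rewrite dhE // Tv mulr0 => /(_ erefl)/eqP.
by rewrite derive_grad_norm_height // mulf_eq0 (negbTE (cos0 p)) => /eqP.
Qed.

(** The covariant derivative of T along itself, whose vanishing means that the
integral curves of T are geodesics. *)
Definition acceleration a p := covD D idfun T a a p (T a p).

Let T_diff a p : dom a p -> differentiable (T a \o coordV a) (coord a p).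
Proof. exact: differentiable_field. Qed.

Let id_cont p : {for p, continuous (@idfun M)}.
Proof. by []. Qed.

Let dw a p u : dom a p -> differentiable
  (fun x => ip g a (coordV a x) (T a (coordV a x)) u) (coord a p).
Proof.
move=> ap.
exact: (differentiable_ip_along M_mfd M_mfd g_metric (@id_cont p)
  (differentiable_rep_id M_mfd ap) ap ap (T_diff ap) (differentiable_cst u _)).
Qed.

Lemma derive_ip_T a p u v : dom a p ->
  'D_v (fun x => ip g a (coordV a x) (T a (coordV a x)) u) (coord a p) =
  ip g a p (covD D idfun T a a p v) u + ip g a p (T a p) (D a p v u).
Proof.
move=> ap.
have /= E := derive_ip_along M_mfd M_mfd (v := T a \o coordV a) (w := cst u) v g_metric D_LC
  (@id_cont p) (differentiable_rep_id M_mfd ap) ap ap (T_diff ap)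
  (differentiable_cst u _).
apply: etrans E _.
by rewrite derive_cst add0r /covD (dmap_id M_mfd v ap) (coordK M_mfd ap).
Qed.

(** Differentiate <T, T> = 1. *)
Lemma covD_T_orth a p u : dom a p ->
  ip g a p (covD D idfun T a a p u) (T a p) = 0.
Proof.
move=> ap.
have /= E := derive_ip_along M_mfd M_mfd (v := T a \o coordV a) (w := T a \o coordV a) u g_metric D_LC
  (@id_cont p) (differentiable_rep_id M_mfd ap) ap ap (T_diff ap) (T_diff ap).
have nE : \forall x \near coord a p,
    ip g a (coordV a x) (T a (coordV a x)) (T a (coordV a x)) = cst 1 x.
  have := near_coord M_mfd ap (near_dom M_mfd ap).
  by apply: filterS => x [ax _ _] /=; rewrite T1.
move: E; rewrite (near_eq_derive _ nE) derive_cst.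
rewrite (dmap_id M_mfd u ap) (coordK M_mfd ap).
rewrite -[X in X + D _ _ _ _]/('D_u (T a \o coordV a) (coord a p)).
have cE : covD D idfun T a a p u =
    'D_u (T a \o coordV a) (coord a p) + D a p u (T a p).
  by rewrite /covD (dmap_id M_mfd u ap).
rewrite -cE (ipC g_metric (T a p)) // -mulr2n => /esym/eqP.
by rewrite mulrn_eq0 /= => /eqP.
Qed.

(** The derivatives D_v D_u h and D_u D_v h, computed from D_u h = sin theta <T, u>,
agree; the Christoffel terms cancel because the torsion vanishes.  For v = T and
u orthogonal to T all but the two terms of the statement drop out. *)
Lemma ip_acceleration a p u : dom a p -> ip g a p (T a p) u = 0 ->
  sin (theta p) * ip g a p (acceleration a p) u = cos (theta p) * dfun theta a p u.
Proof.
move=> ap Tu; pose H := h \o coordV a; pose x0 := coord a p.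
pose sn := sin \o (theta \o coordV a).
pose w u' x := ip g a (coordV a x) (T a (coordV a x)) u'.
have dsn : differentiable sn x0.
  exact: differentiable_comp1 (theta_diff ap) (is_derive_sin _).
have nd : \forall x \near x0, dom a (coordV a x) /\ coord a (coordV a x) = x.
  have := near_coord M_mfd ap (near_dom M_mfd ap).
  by apply: filterS => x [].
have nE u' : \forall x \near x0, sn x * w u' x = 'D_u' H x.
  by apply: filterS nd => x [ax xE]; rewrite /w /sn /= -dhE // /dfun xE.
(* the formula for dh itself shows that dh is differentiable *)
have dDH u' : differentiable (fun x => 'D_u' H x) x0.
  apply: near_eq_differentiable (nE u') _.
  by apply: differentiableM => //; exact: dw.
have DDH u' v' : 'D_v' (fun x => 'D_u' H x) x0 =
    sin (theta p) * (ip g a p (covD D idfun T a a p v') u' +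
                     ip g a p (T a p) (D a p v' u')) +
    ip g a p (T a p) u' * (cos (theta p) * dfun theta a p v').
  have E : 'D_v' (fun x => sn x * w u' x) x0 = 'D_v' (fun x => 'D_u' H x) x0.
    exact: near_eq_derive (nE u').
  apply: etrans (esym E) _.
  have E2 := deriveM (v := v') (diff_derivable dsn) (diff_derivable (dw u' ap)).
  apply: etrans E2 _.
  rewrite (derive_ip_T _ _ ap).
  rewrite (derive_comp1 v' (theta_diff ap) (is_derive_sin _)) /=.
  by rewrite /w /sn /= /x0 (coordK M_mfd ap).
have ndH : \forall x \near x0, differentiable H x.
  by apply: filterS nd => x [ax xE]; rewrite -xE; exact: h_diff.
have E := young ndH (dDH u) (dDH (T a p)).
move: (etrans (esym (DDH u (T a p))) (etrans E (DDH (T a p) u))).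
move: (covD_T_orth u ap); rewrite /acceleration.
generalize (covD D idfun T a a p (T a p)) (covD D idfun T a a p u) => c1 c2.
generalize (dfun theta a p (T a p)) (dfun theta a p u) => t1 t2.
case: D_LC => _ /(_ a p u (T a p) ap) -> _.
generalize (D a p (T a p) u) => d.
move=> c2T; rewrite Tu (T1 ap) c2T mul0r addr0 mul1r add0r.
by rewrite mulrDr [X in _ = X -> _]addrC => /addIr.
Qed.

Lemma angle_iff_acceleration :
  angle_constant_orthogonally g T theta <->
  forall a p, dom a p -> acceleration a p = 0.
Proof.
have s0 p : sin (theta p) != 0 by rewrite gt_eqF.
split=> H a p.
  move=> ap; rewrite (@parallel_of_orthogonal _ _ (g a p) (acceleration a p) (T a p)).
  - by rewrite [gram _ _ _](covD_T_orth (T a p) ap) scale0r.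
  - exact: metric_sym.
  - by move=> v v0; case: g_metric => _ pg _ _; exact: pg.
  - exact: T1.
  - move=> v vT; have vT' : ip g a p (T a p) v = 0 by rewrite (ipC g_metric).
    apply: (mulfI (s0 p)); rewrite mulr0 [LHS](ip_acceleration ap vT').
    by rewrite H ?mulr0.
move=> v ap; rewrite (ipC g_metric) // => Tv.
have := ip_acceleration ap Tv; rewrite H // ip0l mulr0 => /esym/eqP.
by rewrite mulf_eq0 (negbTE (cos0 p)) => /eqP.
Qed.

End unit_gradient_direction.

(** * Existence of solutions of ordinary differential equations *)

Section euler.
Variables (R : realType) (W : normedModType R) (V : W -> W) (x0 : W).
Variables (r L K : R).
Hypotheses (r0 : 0 < r) (L0 : 0 <= L) (K0 : 0 < K).
Hypothesis V_bound : forall x, `|x - x0| <= r -> `|V x| <= K.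
Hypothesis V_lip : forall x y, `|x - x0| <= r -> `|y - x0| <= r ->
  `|V x - V y| <= L * `|x - y|.

Definition euler (h : R) (k : nat) : W := iter k (fun z => z + h *: V z) x0.

Lemma euler_ball h N k : 0 <= h -> N%:R * h * K <= r -> (k <= N)%N ->
  `|euler h k - x0| <= k%:R * h * K.
Proof.
move=> h0 hN; elim: k => [|k IH] kN.
  by rewrite subrr normr0 !mul0r.
have {}IH := IH (ltnW kN).
have kr : `|euler h k - x0| <= r.
  apply: (le_trans IH); apply: le_trans hN.
  by rewrite !ler_wpM2r ?(ltW K0) // ler_nat ltnW.
rewrite /= -/(euler h k) addrAC (le_trans (ler_normD _ _)) //.
rewrite -[k.+1%:R]natr1 !mulrDl mul1r lerD // normrZ ger0_norm //.
by rewrite ler_wpM2l // V_bound.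
Qed.

Lemma euler_in_ball h N k : 0 <= h -> N%:R * h * K <= r -> (k <= N)%N ->
  `|euler h k - x0| <= r.
Proof.
move=> h0 hN kN; apply: (le_trans (euler_ball h0 hN kN)); apply: le_trans hN.
by rewrite !ler_wpM2r ?(ltW K0) // ler_nat.
Qed.

Lemma euler_dist h N j i : 0 <= h -> N%:R * h * K <= r -> (j + i <= N)%N ->
  `|euler h (j + i) - euler h j| <= i%:R * h * K.
Proof.
move=> h0 hN; elim: i => [|i IH] jiN.
  by rewrite addn0 subrr normr0 !mul0r.
rewrite addnS in jiN *; have {}IH := IH (ltnW jiN).
rewrite /= -/(euler h (j + i)) addrAC (le_trans (ler_normD _ _)) //.
rewrite -[i.+1%:R]natr1 !mulrDl mul1r lerD // normrZ ger0_norm //.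
by rewrite ler_wpM2l // V_bound // (euler_in_ball h0 hN) // ltnW.
Qed.

(** Each step adds h (V (euler h (j + i)) - V (euler h j)) to the error, which is at
most h L (i h K) by [euler_dist]; and i^2 + i <= (i + 1)^2. *)
Lemma euler_err h N j i : 0 <= h -> N%:R * h * K <= r -> (j + i <= N)%N ->
  `|euler h (j + i) - euler h j - (i%:R * h) *: V (euler h j)|
    <= L * K * (i%:R * h) ^+ 2.
Proof.
move=> h0 hN; elim: i => [|i IH] jiN.
  by rewrite addn0 subrr mul0r scale0r subrr normr0 expr0n mulr0.
rewrite addnS in jiN *; have {}IH := IH (ltnW jiN).
rewrite /= -/(euler h (j + i)).
have -> : euler h (j + i) + h *: V (euler h (j + i)) - euler h j -
    (i.+1%:R * h) *: V (euler h j) =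
    (euler h (j + i) - euler h j - (i%:R * h) *: V (euler h j)) +
    h *: (V (euler h (j + i)) - V (euler h j)).
  rewrite -[i.+1%:R]natr1 mulrDl mul1r scalerDl scalerBr opprD !addrA.
  by congr (_ - _); rewrite (addrAC _ (h *: _)) (addrAC _ (h *: _)).
apply: (le_trans (ler_normD _ _)).
have le2 : `|h *: (V (euler h (j + i)) - V (euler h j))| <= h * (L * (i%:R * h * K)).
  rewrite normrZ ger0_norm // ler_wpM2l //.
  apply: le_trans (V_lip _ _) _.
  - by rewrite (euler_in_ball h0 hN) // ltnW.
  - by rewrite (euler_in_ball h0 hN) // (leq_trans (leq_addr i j)) // ltnW.
  - by rewrite ler_wpM2l // (euler_dist h0 hN) // ltnW.
apply: (le_trans (lerD IH le2)).
rewrite -[i.+1%:R]natr1; have i0 : 0 <= i%:R :> R by [].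
have LK0 : 0 <= L * K by rewrite mulr_ge0 // ltW.
have -> : L * K * (i%:R * h) ^+ 2 + h * (L * (i%:R * h * K)) =
    L * K * ((i%:R * h) ^+ 2 + i%:R * h ^+ 2) by ring.
by rewrite ler_wpM2l //; nra.
Qed.

Let d := r / K.
Let step N := d / N.+1%:R.

(** The step function through the Euler points of mesh (r / K) / (N + 1).  Within
time r / K the points cannot leave the ball of radius r; the minimum freezes the
function afterwards, so that it stays in the ball at all times. *)
Definition euler_step (N : nat) (t : R) : W :=
  euler (step N) (minn (Num.truncn (t / step N)) N.+1).

Let d0 : 0 < d. Proof. by rewrite divr_gt0. Qed.
Let step0 N : 0 < step N. Proof. by rewrite divr_gt0. Qed.
Let stepE N : N.+1%:R * step N = d.
Proof. by rewrite /step mulrC divfK // pnatr_eq0. Qed.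
Let stepK N : N.+1%:R * step N * K <= r.
Proof. by rewrite stepE /d divfK // gt_eqF. Qed.

Lemma euler_step_ball N t : `|euler_step N t - x0| <= r.
Proof. exact: (euler_in_ball (ltW (step0 N)) (stepK N) (geq_minr _ _)). Qed.

Lemma euler_step0 N : euler_step N 0 = x0.
Proof. by rewrite /euler_step mul0r truncn0 min0n. Qed.

(** Rounding s and t down to multiples of the mesh changes t - s by at most one
mesh, and reduces the claim to [euler_err]. *)
Lemma euler_step_err N s t : 0 <= s -> s <= t -> t <= d ->
  `|euler_step N t - euler_step N s - (t - s) *: V (euler_step N s)|
    <= L * K * (t - s + step N) ^+ 2 + step N * K.
Proof.
move=> s0 st td; have h0 := step0 N; set h := step N in h0 *.
have cell u : 0 <= u -> u <= d ->
    exists k, [/\ euler_step N u = euler h k, (k <= N.+1)%N & k%:R * h <= u < k%:R * h + h].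
  move=> u0 ud; have uh0 : 0 <= u / h by rewrite divr_ge0 // ltW.
  have /andP[k1 k2] := truncn_itv uh0.
  exists (Num.truncn (u / h)).
  have kN : (Num.truncn (u / h) <= N.+1)%N.
    rewrite -(ler_nat R); apply: (le_trans k1).
    by rewrite ler_pdivrMr // stepE.
  split=> //; first by rewrite /euler_step (minn_idPl kN).
  rewrite -ler_pdivlMr // k1 /=.
  by rewrite -[X in _ + X]mul1r -mulrDl natr1 -ltr_pdivrMr.
have [k [kE kN /andP[k1 k2]]] := cell t (le_trans s0 st) td.
have [j [jE jN /andP[j1 j2]]] := cell s s0 (le_trans st td).
have jk : (j <= k)%N.
  rewrite -ltnS -(ltr_nat R) -natr1.
  rewrite -(ltr_pM2r h0) mulrDl mul1r; lra.
rewrite kE jE; have := @euler_err h N.+1 j (k - j) (ltW h0) (stepK N).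
rewrite subnKC // => /(_ kN) err.
set tau := (k - j)%:R * h in err.
have tauE : tau = k%:R * h - j%:R * h by rewrite /tau natrB // mulrBl.
have -> : euler h k - euler h j - (t - s) *: V (euler h j) =
    (euler h k - euler h j - tau *: V (euler h j)) +
    (tau - (t - s)) *: V (euler h j).
  by rewrite (scalerBl tau) addrA subrK.
apply: (le_trans (ler_normD _ _)); apply: lerD.
  apply: (le_trans err); rewrite ler_wpM2l ?mulr_ge0 ?(ltW K0) //.
  have tau0 : 0 <= tau by rewrite mulr_ge0 // ltW.
  by rewrite ler_pXn2r ?nnegrE //; lra.
rewrite normrZ ler_pM //.
  by rewrite ler_norml; apply/andP; split; lra.
apply: V_bound; exact: (euler_in_ball (ltW h0) (stepK N) jN).
Qed.

Lemma step_cvg : step N @[N --> \oo] --> (0 : R).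
Proof.
rewrite -(mulr0 d); apply: cvgM; first exact: cvg_cst.
exact: cvg_harmonic.
Qed.

End euler.

Section ode.
Variables (R : realType) (n : nat) (V : 'rV[R]_n -> 'rV[R]_n) (x0 : 'rV[R]_n).
Variables (r L K : R).
Hypotheses (r0 : 0 < r) (L0 : 0 <= L) (K0 : 0 < K).
Hypothesis V_bound : forall x, `|x - x0| <= r -> `|V x| <= K.
Hypothesis V_lip : forall x y, `|x - x0| <= r -> `|y - x0| <= r ->
  `|V x - V y| <= L * `|x - y|.

Let ball_compact : compact [set x : 'rV[R]_n | `|x - x0| <= r].
Proof.
have -> : [set x : 'rV[R]_n | `|x - x0| <= r] = closed_ball x0 r.
  rewrite closed_ballE //; apply/seteqP; split=> x /=.
    by rewrite /closed_ball_ /= distrC.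
  by rewrite /closed_ball_ /= distrC.
apply: bounded_closed_compact; last exact: closed_ball_closed.
rewrite closed_ballE //; exists (`|x0| + r); split; first exact: num_real.
move=> M /ltW lM x; rewrite /closed_ball_ /= => xr; apply: le_trans lM.
by rewrite -[X in `|X|](subKr x0) (le_trans (ler_normB _ _)) // lerD2l.
Qed.

Let proj_near (y : {ptws R -> 'rV[R]_n}) (t : R) (e : R) : 0 < e ->
  \forall z \near y, `|z t - y t| < e.
Proof.
move=> e0; have := @proj_continuous R (fun _ => 'rV[R]_n) t y.
move=> /cvgrPdist_lt /(_ e e0) H.
have {}H := H (nbhs_filter y).
by apply: (@filterS _ (nbhs y) (nbhs_filter y) _ _ _ H) => z /=; rewrite distrC.
Qed.

(** The step functions live in a product of closed balls, one for each time, which is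
compact by Tychonoff's theorem.  A cluster point y for pointwise convergence is
approached at any two given times s and t simultaneously, which suffices to pass
to the limit in [euler_step_err].  The quadratic estimate that survives is an
integral-free form of y' = V(y). *)
Lemma ode_forward : exists y : R -> 'rV[R]_n,
  [/\ y 0 = x0, (forall t, `|y t - x0| <= r) &
      forall s t, 0 <= s -> s <= t -> t <= r / K ->
        `|y t - y s - (t - s) *: V (y s)| <= L * K * (t - s) ^+ 2].
Proof.
pose Y (N : nat) : {ptws R -> 'rV[R]_n} := euler_step V x0 r K N.
have Yr N t : `|Y N t - x0| <= r by exact: euler_step_ball.
pose B := [set f : {ptws R -> 'rV[R]_n} | forall t, `|f t - x0| <= r].
have cB : compact B.
  exact: (@tychonoff R (fun _ => 'rV[R]_n) _ (fun _ => ball_compact)).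
have [|y [By cy]] := cB (Y @ \oo) _.
  by exists 0%N => // N _ t; exact: Yr.
have approx (P : nat -> Prop) (s t e : R) : (\forall N \near \oo, P N) -> 0 < e ->
    exists N, [/\ P N, `|Y N s - y s| < e & `|Y N t - y t| < e].
  move=> PN e0.
  have [||z [[N [PN' ->]] [zs zt]]] := cy [set z | exists N, P N /\ z = Y N]
      [set z | `|z s - y s| < e /\ `|z t - y t| < e].
  - by apply: filterS PN => N PN' /=; exists N.
  - by apply: filterI; exact: proj_near.
  by exists N.
exists y; split=> [|//|s t s0 st td].
  apply/eqP; rewrite -subr_eq0 -normr_le0; apply/ler_addgt0Pl => e e0.
  rewrite addr0; have [|N [_ N1 _]] := approx (fun=> True) 0 0 e _ e0.
    exact: filterE.
  by move: N1; rewrite /Y euler_step0 // distrC => /ltW.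
pose h (N : nat) := r / K / N.+1%:R.
have hc : (L * K * (t - s + h N) ^+ 2 + h N * K) @[N --> \oo] -->
    L * K * (t - s) ^+ 2.
  have hN : h N @[N --> \oo] --> (0 : R) by exact: step_cvg.
  rewrite -[X in _ --> X]addr0 -[X in _ --> _ + X](mul0r K).
  apply: cvgD; last by apply: cvgM => //; exact: cvg_cst.
  apply: cvgM; first exact: cvg_cst.
  rewrite -[t - s in X in _ --> X]addr0 expr2; under eq_fun do rewrite expr2.
  by apply: cvgM; apply: cvgD => //; exact: cvg_cst.
apply/ler_addgt0Pr => e e0.
(* Replacing y by a step function costs e / C at each of s and t, and (t - s) L times
   this through V (y s); the excess in the estimate of the step function costs
   another e / C. *)
pose C := 3 + (t - s) * L.
have ts0 : 0 <= t - s by rewrite subr_ge0.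
have tsL : 0 <= (t - s) * L by rewrite mulr_ge0.
have C0 : 0 < C by rewrite ltr_pwDl.
have eC0 : 0 < e / C by rewrite divr_gt0.
have near_le : \forall N \near \oo,
    L * K * (t - s + h N) ^+ 2 + h N * K <= L * K * (t - s) ^+ 2 + e / C.
  move/cvgrPdist_lt : hc => /(_ _ eC0); apply: filterS => N.
  rewrite distrC => /ltW /(le_trans (ler_norm _)).
  by rewrite lerBlDl.
have [N [PN Ns Nt]] := approx _ s t _ near_le eC0.
have err := euler_step_err r0 L0 K0 V_bound V_lip N s0 st td.
have := le_trans err PN.
rewrite -/(Y N) => {}err.
have -> : y t - y s - (t - s) *: V (y s) =
    (Y N t - Y N s - (t - s) *: V (Y N s)) - (Y N t - y t) + (Y N s - y s) +
    (t - s) *: (V (Y N s) - V (y s)).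
  rewrite scalerBr.
  set a := Y N t; set b := Y N s; set p := _ *: V b; set q := _ *: V _.
  by apply/rowP => i; rewrite !mxE; ring.
have VV : `|(t - s) *: (V (Y N s) - V (y s))| <= (t - s) * L * (e / C).
  rewrite normrZ ger0_norm // -mulrA ler_wpM2l //.
  apply: (le_trans (V_lip (Yr N s) (By s))).
  by rewrite ler_wpM2l // ltW.
apply: (le_trans (ler_normD _ _)); apply: (le_trans (lerD (ler_normD _ _) VV)).
apply: (le_trans (lerD (lerD (ler_normB _ _) (lexx _)) (lexx _))).
have eE : e = e / C * 3 + (t - s) * L * (e / C).
  by rewrite -[LHS](@divfK _ C) ?gt_eqF // /C; ring.
move: Ns Nt err => /ltW Ns /ltW Nt err.
apply: (le_trans (lerD (lerD (lerD err Nt) Ns) (lexx _))).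
lra.
Qed.

(** The forward estimate is based at the earlier of the two times; since V is
Lipschitz, the base can be moved to the later one. *)
Lemma ode_forward_sym : exists y : R -> 'rV[R]_n, exists C : R,
  [/\ y 0 = x0, (forall t, `|y t - x0| <= r) &
      forall s t, 0 <= s <= r / K -> 0 <= t <= r / K ->
        `|y t - y s - (t - s) *: V (y s)| <= C * (t - s) ^+ 2].
Proof.
have [y [y0 yr yE]] := ode_forward; pose d := r / K.
have LK0 : 0 <= L * K by rewrite mulr_ge0 // ltW.
exists y, (L * K + L * (K + L * K * d)); split=> // s t.
move=> /andP[s0 sd] /andP[t0 td].
have d0 : 0 < d by rewrite divr_gt0.
have LKd : 0 <= L * (K + L * K * d).
  by rewrite mulr_ge0 // addr_ge0 ?(ltW K0) // mulr_ge0 // (ltW d0).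
have [st|/ltW ts] := leP s t.
  apply: (le_trans (yE s t s0 st td)).
  by rewrite ler_wpM2r ?sqr_ge0 // lerDl.
have est := yE t s t0 ts sd.
have st0 : 0 <= s - t by rewrite subr_ge0.
have -> : y t - y s - (t - s) *: V (y s) =
    (s - t) *: (V (y s) - V (y t)) - (y s - y t - (s - t) *: V (y t)).
  by apply/rowP => i; rewrite !mxE; ring.
apply: (le_trans (ler_normB _ _)).
have -> : (t - s) ^+ 2 = (s - t) ^+ 2 by ring.
rewrite addrC mulrDl lerD //.
rewrite normrZ ger0_norm // expr2 mulrA mulrC; apply: ler_wpM2r => //.
apply: (le_trans (V_lip (yr s) (yr t))); rewrite -mulrA ler_wpM2l //.
have -> : y s - y t = (y s - y t - (s - t) *: V (y t)) + (s - t) *: V (y t).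
  by rewrite subrK.
apply: (le_trans (ler_normD _ _)); rewrite addrC mulrDl lerD //.
  by rewrite normrZ ger0_norm // mulrC ler_wpM2r // V_bound.
apply: (le_trans est); rewrite expr2 mulrA ler_wpM2r // ler_wpM2l // /d; lra.
Qed.

End ode.

Lemma quadratic_is_derive (R : realType) (W : normedModType R) (y : R -> W)
    (s C : R) (w : W) :
  (\forall t \near s, `|y t - y s - (t - s) *: w| <= C * (t - s) ^+ 2) ->
  is_derive s 1 y w.
Proof.
move=> est.
suff cv : (h^-1 *: ((y \o shift s) (h *: 1) - y s)) @[h --> 0^'] --> w.
  apply: DeriveDef; first by apply/cvg_ex; exists w.
  by rewrite /derive; apply: cvg_lim.
apply/cvgrPdist_le => e e0.
have est0 : \forall h \near (0 : R),
    `|y (h + s) - y s - h *: w| <= C * h ^+ 2.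
  move: est; rewrite (near_shift 0 s) subr0.
  by apply: filterS => h /=; rewrite addrK.
have C10 : 0 < `|C| + 1 by rewrite ltr_wpDl.
have Ch : \forall h \near (0 : R)^', `|h| <= e / (`|C| + 1).
  by apply: (@dnbhs0_le R R); rewrite divr_gt0.
near=> h.
have h0 : h != 0 by near: h; exact: nbhs_dnbhs_neq.
have H1 : `|y (h + s) - y s - h *: w| <= C * h ^+ 2.
  by near: h; apply: cvg_within; exact: est0.
have H2 : `|h| * (`|C| + 1) <= e by rewrite -ler_pdivlMr //; near: h; exact: Ch.
rewrite /= [h *: 1]mulr1 distrC.
have -> : h^-1 *: (y (h + s) - y s) - w = h^-1 *: (y (h + s) - y s - h *: w).
  by rewrite [RHS]scalerBr scalerA mulVf // scale1r.
rewrite normrZ normfV ler_pdivrMl ?normr_gt0 //.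
apply: (le_trans H1); apply: (@le_trans _ _ (`|h| * (`|h| * (`|C| + 1)))).
  rewrite mulrA -expr2 real_normK ?num_real // mulrC ler_wpM2l ?sqr_ge0 //.
  by rewrite (le_trans (ler_norm _)) // lerDl.
by rewrite ler_wpM2l.
Unshelve. all: by end_near. Qed.

(** A forward solution for V, and a forward solution for - V run backwards, fit
together at time 0: there the quadratic estimates hold on both sides with the same
slope V x0. *)
Lemma ode_exists (R : realType) (n : nat) (V : 'rV[R]_n -> 'rV[R]_n)
    (x0 : 'rV[R]_n) (r L K : R) :
  0 < r -> 0 <= L -> 0 < K ->
  (forall x, `|x - x0| <= r -> `|V x| <= K) ->
  (forall x y, `|x - x0| <= r -> `|y - x0| <= r ->
     `|V x - V y| <= L * `|x - y|) ->
  exists y : R -> 'rV[R]_n,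
    [/\ y 0 = x0, (forall t, `|y t - x0| <= r) &
        forall t : R, `|t| < r / K -> is_derive t 1 y (V (y t))].
Proof.
move=> r0 L0 K0 Vb Vl.
have [y1 [C1 [y10 y1r y1E]]] := ode_forward_sym r0 L0 K0 Vb Vl.
have [||y2 [C2 [y20 y2r y2E]]] := @ode_forward_sym R n (fun x => - V x) x0 r L K r0 L0 K0.
- by move=> x xr; rewrite normrN Vb.
- by move=> x y xr yr; rewrite -opprD normrN Vl.
pose d := r / K; pose y t := if 0 <= t then y1 t else y2 (- t).
have d0 : 0 < d by rewrite divr_gt0.
exists y; split=> [|t|s sd]; first by rewrite /y lexx.
  by rewrite /y; case: ifP.
have pos t u : 0 <= t <= d -> 0 <= u <= d ->
    `|y u - y t - (u - t) *: V (y t)| <= C1 * (u - t) ^+ 2.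
  by move=> /[dup] /andP[t0 _] td /[dup] /andP[u0 _] ud; rewrite /y t0 u0 y1E.
have yN t : t <= 0 -> y t = y2 (- t).
  rewrite /y le_eqVlt => /orP[/eqP ->|t0]; first by rewrite lexx oppr0 y10 y20.
  by rewrite leNgt t0.
have neg t u : - d <= t <= 0 -> - d <= u <= 0 ->
    `|y u - y t - (u - t) *: V (y t)| <= C2 * (u - t) ^+ 2.
  move=> /andP[td t0] /andP[ud u0]; rewrite !yN //.
  have := y2E (- t) (- u); rewrite -/d; rewrite !oppr_ge0 t0 u0 /=.
  rewrite lerNl td lerNl ud => /(_ isT isT).
  have -> : - u - - t = - (u - t) by rewrite opprD.
  by rewrite scalerN scaleNr opprK sqrrN.
apply: (@quadratic_is_derive _ _ _ _ (Num.max C1 C2)).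
have nd : \forall u \near s, `|u| < d.
  move: sd; rewrite ltr_norml => /andP[/lt_nbhsr sd1 /lt_nbhsl sd2].
  by apply: filterS2 sd1 sd2 => u; rewrite ltr_norml => -> ->.
have leC1 u : C1 * (u - s) ^+ 2 <= Num.max C1 C2 * (u - s) ^+ 2.
  by rewrite ler_wpM2r ?sqr_ge0 // le_max lexx.
have leC2 u : C2 * (u - s) ^+ 2 <= Num.max C1 C2 * (u - s) ^+ 2.
  by rewrite ler_wpM2r ?sqr_ge0 // le_max lexx orbT.
move: sd; rewrite ltr_norml => /andP[/ltW sd1 /ltW sd2].
have [s0|s0|s0] := ltgtP s 0.
- have ns : \forall u \near s, u < 0 by exact: lt_nbhsl.
  apply: filterS2 nd ns => u; rewrite ltr_norml => /andP[/ltW ud1 _] /ltW u0.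
  by apply: le_trans (leC2 u); apply: neg; apply/andP; split => //; exact: ltW.
- have ns : \forall u \near s, 0 < u by exact: lt_nbhsr.
  apply: filterS2 nd ns => u; rewrite ltr_norml => /andP[_ /ltW ud1] /ltW u0.
  by apply: le_trans (leC1 u); apply: pos; apply/andP; split => //; exact: ltW.
- apply: filterS nd => u; rewrite ltr_norml => /andP[/ltW ud1 /ltW ud2].
  have [u0|/ltW u0] := leP 0 u.
    by apply: le_trans (leC1 u); apply: pos; rewrite ?u0 // s0 lexx ltW.
  by apply: le_trans (leC2 u); apply: neg; rewrite ?u0 ?ud1 // s0 lexx oppr_le0 ltW.
Qed.

Lemma mx_norm_entry (R : realType) m n (A : 'M[R]_(m, n)) i j :
  `|A i j| <= `|A|.
Proof. by rewrite [leRHS]/Num.Def.normr/= mx_normrE; exact: (le_bigmax _ _ (i, j)). Qed.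

Lemma mx_norm_le (R : realType) m n (A : 'M[R]_(m, n)) c : 0 <= c ->
  (forall i j, `|A i j| <= c) -> `|A| <= c.
Proof.
move=> c0 Ac; rewrite [leLHS]/Num.Def.normr/= mx_normrE.
by apply: bigmax_le => // -[i j] _; exact: Ac.
Qed.

Lemma derive_coord_bound (R : realType) n k (f : 'rV[R]_n -> 'rV[R]_k)
    (x v : 'rV[R]_n) : differentiable f x ->
  `|'D_v f x| <= `|v| * \sum_i `|'D_(delta_mx 0 i) f x|.
Proof.
move=> df; rewrite {1}[v]row_sum_delta deriveE // linear_sum /= mulr_sumr.
apply: (le_trans (ler_norm_sum _ _ _)); apply: ler_sum => i _.
by rewrite linearZ /= normrZ -deriveE // ler_wpM2r // mx_norm_entry.
Qed.

(** The directional derivatives of f are bounded near x0 because they are continuous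
at x0, and the mean value theorem is applied along segments, which stay in the
ball.  The constants are in the form needed by [ode_exists]; P records what else
has to hold on the ball. *)
Lemma locally_lipschitz (R : realType) n k (f : 'rV[R]_n -> 'rV[R]_k)
    (x0 : 'rV[R]_n) (P : set 'rV[R]_n) :
  (\forall x \near x0, differentiable f x) ->
  (forall v, {for x0, continuous (fun x => 'D_v f x)}) ->
  (\forall x \near x0, P x) ->
  exists r L K, [/\ 0 < r, 0 <= L, 0 < K,
    (forall x, `|x - x0| <= r -> P x /\ `|f x| <= K) &
    (forall x y, `|x - x0| <= r -> `|y - x0| <= r ->
      `|f x - f y| <= L * `|x - y|)].
Proof.
move=> df cD nP.
pose L := \sum_(i < n) (`|'D_(delta_mx 0 i) f x0| + 1).
have L0 : 0 <= L by apply: sumr_ge0 => i _; rewrite addr_ge0.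
have nL : \forall x \near x0, \sum_i `|'D_(delta_mx 0 i) f x| <= L.
  have H (i : 'I_n) : \forall x \near x0,
      `|'D_(delta_mx 0 i) f x| <= `|'D_(delta_mx 0 i) f x0| + 1.
    have /cvgrPdist_lt /(_ 1 ltr01) := cD (delta_mx 0 i).
    apply: filterS => x; rewrite distrC => /ltW D1.
    rewrite -[X in `|X| <= _](subrK ('D_(delta_mx 0 i) f x0)).
    by rewrite (le_trans (ler_normD _ _)) // addrC lerD2l.
  have {}H : \forall x \near x0, forall i : 'I_n,
      `|'D_(delta_mx 0 i) f x| <= `|'D_(delta_mx 0 i) f x0| + 1.
    by have := filter_forall _ H; exact.
  apply: filterS H => x Hx.
  by apply: ler_sum => i _; exact: Hx.
have cf : {for x0, continuous f}.
  exact: differentiable_continuous (nbhs_singleton df).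
have nK : \forall x \near x0, `|f x| <= `|f x0| + 1.
  have /cvgrPdist_lt /(_ 1 ltr01) := cf.
  apply: filterS => x; rewrite distrC => /ltW D1.
  rewrite -[X in `|X| <= _](subrK (f x0)).
  by rewrite (le_trans (ler_normD _ _)) // addrC lerD2l.
have nA : \forall x \near x0, (differentiable f x /\
    \sum_i `|'D_(delta_mx 0 i) f x| <= L) /\ (P x /\ `|f x| <= `|f x0| + 1).
  by apply: filterS2 (filterI df nL) (filterI nP nK) => x [? ?] [? ?].
move/nbhs_ballP : nA => [e /= e0 eP].
have e20 : 0 < e / 2 by rewrite divr_gt0.
have inb x : `|x - x0| <= e / 2 -> ball x0 e x.
  move=> xe; rewrite -ball_normE /ball_ /= distrC.
  by apply: le_lt_trans xe _; rewrite gtr_pMr // invf_lt1 // ltr1n.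
exists (e / 2), L, (`|f x0| + 1); split=> //.
- by move=> x /inb /eP[_ []].
move=> x y xr yr; apply: mx_norm_le; first by rewrite mulr_ge0.
move=> i j; rewrite ord1 !mxE.
pose z (t : R) := t *: (x - y) + y.
have zr (t : R) : 0 <= t <= 1 -> `|z t - x0| <= e / 2.
  move=> /andP[t0 t1].
  have -> : z t - x0 = t *: (x - x0) + (1 - t) *: (y - x0).
    by apply/rowP => l; rewrite !mxE; ring.
  apply: (le_trans (ler_normD _ _)); rewrite !normrZ.
  rewrite (ger0_norm t0) ger0_norm ?subr_ge0 //.
  have -> : e / 2 = t * (e / 2) + (1 - t) * (e / 2) by ring.
  by apply: lerD; rewrite ler_wpM2l // subr_ge0.
pose g w := f w 0 j.
have dz (t : R) : 0 <= t <= 1 -> is_derive t 1 (fun t => g (z t)) ('D_(x - y) g (z t)).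
  move=> t01; apply: is_derive_line; apply: differentiable_entry.
  by have [[]] := eP _ (inb _ (zr t t01)).
have [t t01 E] : exists2 t, t \in `]0, 1[%R &
    g (z 1) - g (z 0) = 'D_(x - y) g (z t) * (1 - 0).
  apply: (MVT (f := fun t => g (z t)) (df := fun t => 'D_(x - y) g (z t))) => //.
    by move=> t; rewrite in_itv /= => /andP[/ltW ? /ltW ?]; apply: dz; apply/andP.
  apply: derivable_within_continuous => t; rewrite in_itv /= => t01.
  by case: (dz t t01).
have {}t01 : 0 <= t <= 1 by move: t01; rewrite in_itv /= => /andP[/ltW -> /ltW].
have -> : f x 0 j - f y 0 j = 'D_(x - y) g (z t).
  by move: E; rewrite subr0 mulr1 /g /z scale1r scale0r subrK add0r.
have [[dfz Lz] _] := eP _ (inb _ (zr t t01)).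
rewrite /g -derive_entry //; apply: (le_trans (mx_norm_entry _ _ _)).
apply: (le_trans (derive_coord_bound _ dfz)).
by rewrite mulrC ler_wpM2r.
Qed.

(** * Integral curves *)

Section flow.
Variables (R : realType) (m : nat) (M : atlas R m) (X : vfield M).
Hypotheses (M_mfd : is_manifold M) (X_field : is_vfield X).

(** Solve the equation in one chart; the transformation law of X makes the solution an
integral curve as seen in any other chart. *)
Lemma integral_curve_exists p : exists (J : set R) (c : R -> M),
  [/\ open J, is_interval J, J 0, c 0 = p & integral_curve X J c].
Proof.
have [a ap] := chart_at M_mfd p; pose f := X a \o coordV a.
have sX : smooth_on (coord a @` dom a) f.
  case: X_field => _ /(_ a a); congr (smooth_on (_ @` _) _).
  by rewrite preimage_id setIid.
have nd := near_coord M_mfd ap (near_dom M_mfd ap).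
have df : \forall x \near coord a p, differentiable f x.
  apply: filterS nd => x [ax _ xE].
  by apply: (smooth_on_differentiable sX); exists (coordV a x).
have cD v : {for coord a p, continuous (fun x => 'D_v f x)}.
  have ip : (coord a @` dom a) (coord a p) by exists p.
  exact: differentiable_continuous (smooth_on_differentiable2 sX v ip).
have [r [L [K [r0 L0 K0 fK fL]]]] := locally_lipschitz df cD nd.
have [||y [y0 yr yd]] := @ode_exists R m f (coord a p) r L K r0 L0 K0.
- by move=> x /fK [].
- exact: fL.
exists [set t : R | `|t| < r / K], (coordV a \o y); split.
- rewrite (_ : [set t : R | _] = ball (0 : R) (r / K)); first exact: ball_open.
  apply/seteqP; split=> t; rewrite -ball_normE /ball_ /= sub0r normrN //.
- move=> s t /=; rewrite !ltr_norml => /andP[s1 _] /andP[_ t2] u /andP[su ut].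
  by rewrite ltr_norml (lt_le_trans s1 su) (le_lt_trans ut t2).
- by rewrite /= normr0 divr_gt0.
- by rewrite /= y0 coordK.
move=> t /= tJ; have [dy Dy] := yd t tJ.
have [[_ ay yE] _] := fK _ (yr t).
have cy : {for t, continuous y}.
  by apply: differentiable_continuous; apply/derivable1_diffP.
have cc : {for t, continuous (coordV a \o y)}.
  apply: continuous_comp => //.
  by have := cvg_coordV M_mfd ay; rewrite /continuous_at yE.
split; first exact: cc.
move=> b by_.
have dr : differentiable (rep (@idfun M) a b) (y t).
  rewrite -yE; case: M_mfd => _ _ _ _ /(_ a b) sab.
  by apply: (smooth_on_differentiable sab); exists (coordV a (y t)).
have dy' : differentiable y t by apply/derivable1_diffP.
split; first by apply: diff_derivable; exact: (differentiable_comp dy' dr).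
rewrite /velocity derive1E.
have E := derive_comp (1 : R) dy' dr; apply: etrans E _; rewrite Dy.
case: X_field => /(_ a b (coordV a (y t)) ay by_) -> _.
by rewrite /dmap yE.
Qed.

Section along_curve.
Variables (J : set R) (c : R -> M).
Hypotheses (J_open : open J) (Xc : integral_curve X J c).

(** Along an integral curve the velocity is X evaluated at the curve, so the chain
rule applies. *)
Lemma derive_velocity a t : J t -> dom a (c t) ->
  is_derive t 1 (velocity c a)
    ('D_(X a (c t)) (X a \o coordV a) (coord a (c t))).
Proof.
move=> Jt at_; have [cc /(_ a at_) [dc vc]] := Xc Jt.
have nJ : \forall s \near t, J s by exact: open_nbhs_nbhs.
have na : \forall s \near t, dom a (c s) by apply: cc; exact: (near_dom M_mfd).
have nE : \forall s \near t, ((X a \o coordV a) \o (coord a \o c)) s = velocity c a s.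
  apply: filterS2 nJ na => s Js as_.
  have [_ /(_ a as_) [_ ->]] := Xc Js.
  by rewrite /= (coordK M_mfd as_).
have dc' : differentiable (coord a \o c) t by apply/derivable1_diffP.
have dX : differentiable (X a \o coordV a) ((coord a \o c) t).
  exact: differentiable_field.
apply: (near_eq_is_derive nE); apply: DeriveDef.
  by apply: diff_derivable; exact: differentiable_comp.
have E := derive_comp (1 : R) dc' dX; apply: etrans E _; congr ('D_ _ _ _).
by rewrite -vc /velocity derive1E.
Qed.

Lemma geodesic_iff_acceleration (D : connection M) :
  geodesic D J c <->
  forall t a, J t -> dom a (c t) -> acceleration D X a (c t) = 0.
Proof.
have E t a : J t -> dom a (c t) ->
    derive1 (velocity c a) t + D a (c t) (velocity c a t) (velocity c a t) =
    acceleration D X a (c t).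
  move=> Jt at_; have [_ dv] := derive_velocity Jt at_.
  have [_ /(_ a at_) [_ ->]] := Xc Jt.
  by rewrite derive1E dv /acceleration /covD (dmap_id M_mfd).
split=> [geo t a Jt at_|acc t Jt].
  by rewrite -E //; have [_ /(_ a at_) []] := geo t Jt.
have [cc dc] := Xc Jt; split=> // a at_; have [dca _] := dc a at_.
by have [dv _] := derive_velocity Jt at_; split=> //; rewrite E // acc.
Qed.

End along_curve.

Lemma geodesics_iff_acceleration (D : connection M) :
  integral_curves_geodesic D X <->
  forall a p, dom a p -> acceleration D X a p = 0.
Proof.
split=> [geo a p ap|acc J c oJ _ Xc].
  have [J [c [oJ iJ J0 c0 Xc]]] := integral_curve_exists p.
  have /(geodesic_iff_acceleration oJ Xc) := geo J c oJ iJ Xc.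
  by move=> /(_ 0 a J0); rewrite c0; exact.
by apply/(geodesic_iff_acceleration oJ Xc) => t a _; exact: acc.
Qed.

End flow.

(** The derivative of (g k)^2 = (r s)^2 when r is stationary, d is the derivative of g,
and s, k are the sine and cosine of an angle with derivative t. *)
Lemma product_rule_balance (R : realFieldType) (g r s k d t : R) :
  0 < g -> 0 < r -> 0 < s -> k != 0 ->
  2 * (g * k) * (g * (- s * t) + k * d) = 2 * (r * s) * (r * (k * t) + s * 0) ->
  d = 0 <-> t = 0.
Proof.
move=> g0 r0 s0 k0 E.
have rg0 : 0 < r ^+ 2 + g ^+ 2 by rewrite addr_gt0 // exprn_gt0.
have {}E : g * k * d = s * (r ^+ 2 + g ^+ 2) * t.
  have k2 : 2 * k != 0 by rewrite mulf_neq0.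
  by apply: (mulfI k2); lra.
split=> z0; move: E; rewrite z0 mulr0.
  by move/esym/eqP; rewrite !mulf_eq0 (gt_eqF s0) (gt_eqF rg0) => /eqP.
by move/eqP; rewrite !mulf_eq0 (gt_eqF g0) (negbTE k0) => /eqP.
Qed.

(** * The angle between the hypersurface and X *)

Section hypersurface.
Variables (R : realType) (n : nat).
Variables (Mb : atlas R n.+1) (gb : metric Mb) (Db : connection Mb).
Variable (X : vfield Mb).
Hypotheses (Mb_mfd : is_manifold Mb) (gb_metric : is_metric gb).
Hypothesis (Db_LC : levi_civita gb Db).
Hypotheses (X_field : is_vfield X) (X_conf : closed_conformal Db X).
Variables (M : atlas R n) (gM : metric M).
Variables (iota : M -> Mb) (xi : field_along iota).
Hypotheses (M_mfd : is_manifold M) (gM_metric : is_metric gM).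
Hypothesis (iota_isom : isometric_immersion gM gb iota).
Hypothesis (xi_normal : unit_normal gb iota xi).
Variables (theta : M -> R).
Hypothesis (theta_angle : angle_in_0pi gb iota xi X theta).
Variables (T : vfield M).
Hypothesis (T_def : unit_tangential gb iota xi X T).
Implicit Types (a : chart M) (b : chart Mb) (p : M).

Let X_xi b p := ip gb b (iota p) (X b (iota p)) (xi b p).
Let X_X b p := ip gb b (iota p) (X b (iota p)) (X b (iota p)).
Let normX b p := mnorm gb b (iota p) (X b (iota p)).

Lemma continuous_iota p : {for p, continuous iota}.
Proof. by case: iota_isom => -[+ _] _; exact. Qed.

Lemma differentiable_iota a b p : dom a p -> dom b (iota p) ->
  differentiable (rep iota a b) (coord a p).
Proof.
by case: iota_isom => si _; exact: (differentiable_rep si).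
Qed.

Lemma ip_iota a b p u v : dom a p -> dom b (iota p) ->
  ip gb b (iota p) (dmap iota a b p u) (dmap iota a b p v) = ip gM a p u v.
Proof. by case: iota_isom => _ pres ap bp; rewrite -pres. Qed.

Lemma ipC_amb b p u v : dom b (iota p) ->
  ip gb b (iota p) u v = ip gb b (iota p) v u.
Proof. exact: ipC. Qed.

Lemma ipC_sub a p u v : dom a p -> ip gM a p u v = ip gM a p v u.
Proof. exact: ipC. Qed.

Lemma xi_unit b p : dom b (iota p) -> ip gb b (iota p) (xi b p) (xi b p) = 1.
Proof.
by move=> bp; have [a ap] := chart_at M_mfd p; case: xi_normal => _ /(_ a b p ap bp)[].
Qed.

Lemma xi_orth a b p v : dom a p -> dom b (iota p) ->
  ip gb b (iota p) (dmap iota a b p v) (xi b p) = 0.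
Proof. by move=> ap bp; case: xi_normal => _ /(_ a b p ap bp)[_]. Qed.

Lemma X_X_gt0 b p : dom b (iota p) -> 0 < X_X b p.
Proof.
move=> bp; have [X0 _ _ _] := theta_angle bp.
by case: gb_metric => _ pg _ _; exact: pg.
Qed.

Lemma normX_gt0 b p : dom b (iota p) -> 0 < normX b p.
Proof. by move=> bp; rewrite sqrtr_gt0; exact: X_X_gt0. Qed.

Lemma sqr_normX b p : dom b (iota p) -> normX b p ^+ 2 = X_X b p.
Proof. by move=> bp; rewrite sqr_sqrtr // ltW // X_X_gt0. Qed.

Lemma sin_theta_gt0 p : 0 < sin (theta p).
Proof.
have [b bp] := chart_at Mb_mfd (iota p).
by have [_ t0 tpi _] := theta_angle bp; rewrite sin_gt0_pi // t0.
Qed.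

Lemma X_xiE b p : dom b (iota p) -> X_xi b p = normX b p * cos (theta p).
Proof.
move=> bp; have [_ _ _ ->] := theta_angle bp.
by rewrite ipZl mulVKf // gt_eqF // normX_gt0.
Qed.

(** |X^T|^2 = |X|^2 - <X, xi>^2 by Pythagoras. *)
Lemma mnorm_tangential b p : dom b (iota p) ->
  mnorm gb b (iota p) (tangential gb iota xi X b p) =
  normX b p * sin (theta p).
Proof.
move=> bp.
have H : ip gb b (iota p) (tangential gb iota xi X b p)
                          (tangential gb iota xi X b p) =
         (normX b p * sin (theta p)) ^+ 2.
  have -> : (normX b p * sin (theta p)) ^+ 2 = X_X b p - X_xi b p ^+ 2.
    by rewrite X_xiE // -sqr_normX // !exprMn sin2cos2; ring.
  rewrite /tangential ipDl !ipDr !ipNl !ipNr !ipZl !ipZr xi_unit //.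
  by rewrite (ipC_amb (xi b p)) // -/(X_xi b p) -/(X_X b p); ring.
by rewrite /mnorm H sqrtr_sqr ger0_norm // mulr_ge0 // ltW ?normX_gt0 ?sin_theta_gt0.
Qed.

Lemma dmap_T a b p : dom a p -> dom b (iota p) ->
  dmap iota a b p (T a p) =
  (normX b p * sin (theta p))^-1 *: (X b (iota p) - X_xi b p *: xi b p).
Proof.
by move=> ap bp; case: T_def => _ /(_ a b p ap bp) ->; rewrite mnorm_tangential.
Qed.

Lemma ip_T a b p v : dom a p -> dom b (iota p) ->
  ip gM a p (T a p) v =
  (normX b p * sin (theta p))^-1 *
    ip gb b (iota p) (X b (iota p)) (dmap iota a b p v).
Proof.
move=> ap bp; rewrite -(ip_iota _ _ ap bp) dmap_T //.
rewrite ipZl ipDl ipNl ipZl; congr (_ * _).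
by rewrite (ipC_amb (xi b p)) // (xi_orth _ ap bp) mulr0 subr0.
Qed.

Lemma T_unit a p : dom a p -> ip gM a p (T a p) (T a p) = 1.
Proof.
move=> ap; have [b bp] := chart_at Mb_mfd (iota p).
rewrite (ip_T _ ap bp) dmap_T //.
have s0 := sin_theta_gt0 p; have m0 := normX_gt0 bp.
rewrite ipZr ipDr ipNr ipZr -/(X_X b p) -/(X_xi b p).
have -> : X_X b p - X_xi b p * X_xi b p = (normX b p * sin (theta p)) ^+ 2.
  by rewrite X_xiE // -sqr_normX // !exprMn sin2cos2; ring.
by field; rewrite !gt_eqF.
Qed.

Lemma near_iota a b p : dom a p -> dom b (iota p) ->
  \forall x \near coord a p,
    [/\ dom b (iota (coordV a x)), dom a (coordV a x) & coord a (coordV a x) = x].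
Proof. exact: (near_dom_along M_mfd Mb_mfd (@continuous_iota p)). Qed.

Lemma differentiable_X_iota a b p : dom a p -> dom b (iota p) ->
  differentiable (fun x => X b (iota (coordV a x))) (coord a p).
Proof.
move=> ap bp; apply: (differentiable_field_comp M_mfd Mb_mfd X_field) => //.
- exact: continuous_iota.
- exact: differentiable_iota.
Qed.

Lemma differentiable_xi a b p : dom a p -> dom b (iota p) ->
  differentiable (fun x => xi b (coordV a x)) (coord a p).
Proof. by case: xi_normal => fx _; exact: (differentiable_field_along fx). Qed.

Lemma differentiable_X_X a b p : dom a p -> dom b (iota p) ->
  differentiable (X_X b \o coordV a) (coord a p).
Proof.
move=> ap bp; apply: (differentiable_ip_along M_mfd Mb_mfd gb_metric) => //.
- exact: continuous_iota.
- exact: differentiable_iota.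
- exact: differentiable_X_iota.
- exact: differentiable_X_iota.
Qed.

Lemma differentiable_normX a b p : dom a p -> dom b (iota p) ->
  differentiable (normX b \o coordV a) (coord a p).
Proof.
move=> ap bp; apply: differentiable_sqrt; first exact: differentiable_X_X.
by rewrite /= (coordK M_mfd ap) // X_X_gt0.
Qed.

Lemma differentiable_X_xi a b p : dom a p -> dom b (iota p) ->
  differentiable (X_xi b \o coordV a) (coord a p).
Proof.
move=> ap bp; apply: (differentiable_ip_along M_mfd Mb_mfd gb_metric) => //.
- exact: continuous_iota.
- exact: differentiable_iota.
- exact: differentiable_X_iota.
- exact: differentiable_xi.
Qed.

(** theta is the arc cosine of <X, xi> / |X|, a ratio that stays off -1 and 1. *)
Lemma differentiable_theta a p : dom a p ->
  differentiable (theta \o coordV a) (coord a p).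
Proof.
move=> ap; have [b bp] := chart_at Mb_mfd (iota p).
pose c x := X_xi b (coordV a x) / normX b (coordV a x).
have cE q : dom b (iota q) -> X_xi b q / normX b q = cos (theta q).
  by move=> bq; rewrite X_xiE // mulrAC divff ?mul1r // gt_eqF // normX_gt0.
have nE : \forall x \near coord a p, (acos \o c) x = (theta \o coordV a) x.
  apply: filterS (near_iota ap bp) => x [bx _ _] /=.
  rewrite /c cE // cosK // in_itv /=.
  by have [_ t0 tpi _] := theta_angle bx; rewrite !ltW.
apply: near_eq_differentiable nE _.
have cp : c (coord a p) = cos (theta p) by rewrite /c coordK // cE.
apply: differentiable_comp1.
  apply: differentiableM; first exact: (differentiable_X_xi ap bp).
  apply: differentiableV; first exact: (differentiable_normX ap bp).
  by rewrite /= coordK // gt_eqF // normX_gt0.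
apply: is_derive1_acos; rewrite cp.
have : cos (theta p) ^+ 2 < 1.
  by rewrite cos2sin2 gtrBl exprn_gt0 // sin_theta_gt0.
by move=> c1; apply/andP; split; nra.
Qed.

(** The covariant derivative of X in the direction u is a multiple of u, which is
orthogonal to xi. *)
Lemma derive_X_xi a b p u : dom a p -> dom b (iota p) ->
  'D_u (X_xi b \o coordV a) (coord a p) =
  ip gb b (iota p) (X b (iota p)) (covD Db iota xi a b p u).
Proof.
move=> ap bp.
rewrite (derive_ip_along M_mfd Mb_mfd (w := xi b \o coordV a) u gb_metric Db_LC
  (@continuous_iota p) (differentiable_iota ap bp) ap bp
  (differentiable_X_iota ap bp) (differentiable_xi ap bp)).
rewrite /= !(coordK M_mfd ap).
rewrite (covD_field_comp M_mfd Mb_mfd Db u X_field (@continuous_iota p)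
  (differentiable_iota ap bp) ap bp).
case: X_conf => phi [_ ->] //.
by rewrite ipZl (xi_orth u ap bp) mulr0 add0r.
Qed.

(** The covariant derivative of X in the direction u is a multiple of u, which is
orthogonal to X by assumption. *)
Lemma derive_X_X a b p u : dom a p -> dom b (iota p) ->
  ip gb b (iota p) (X b (iota p)) (dmap iota a b p u) = 0 ->
  'D_u (X_X b \o coordV a) (coord a p) = 0.
Proof.
move=> ap bp Xu.
rewrite (derive_ip_along M_mfd Mb_mfd u gb_metric Db_LC
  (@continuous_iota p) (differentiable_iota ap bp) ap bp
  (differentiable_X_iota ap bp) (differentiable_X_iota ap bp)).
rewrite /= !(coordK M_mfd ap).
rewrite (covD_field_comp M_mfd Mb_mfd Db u X_field (@continuous_iota p)
  (differentiable_iota ap bp) ap bp).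
case: X_conf => phi [_ ->] //.
rewrite (ipC_amb (_ *: _)) // -mulr2n.
by rewrite ipZr Xu mulr0 mul0rn.
Qed.

(** Differentiate <xi, xi> = 1. *)
Lemma covD_xi_orth a b p u : dom a p -> dom b (iota p) ->
  ip gb b (iota p) (covD Db iota xi a b p u) (xi b p) = 0.
Proof.
move=> ap bp.
have := derive_ip_along M_mfd Mb_mfd (v := xi b \o coordV a)
  (w := xi b \o coordV a) u gb_metric Db_LC
  (@continuous_iota p) (differentiable_iota ap bp) ap bp
  (differentiable_xi ap bp) (differentiable_xi ap bp).
rewrite /= !(coordK M_mfd ap) -/(covD Db iota xi a b p u).
rewrite (ipC_amb (xi b p)) // -mulr2n.
have nE : \forall x \near coord a p,
    ip gb b (iota (coordV a x)) (xi b (coordV a x)) (xi b (coordV a x)) = cst 1 x.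
  by apply: filterS (near_iota ap bp) => x [bx _ _]; rewrite xi_unit.
rewrite (near_eq_derive _ nE) derive_cst => /esym/eqP.
by rewrite mulrn_eq0 /= => /eqP.
Qed.

(** Differentiating <xi, d iota(v)> = 0 in the direction u gives
<D_u xi, d iota(v)> = - <xi, D_u (d iota(v))>, and the second fundamental form on the
right is symmetric: second derivatives commute and the torsion vanishes. *)
Lemma covD_xi_sym a b p u v : dom a p -> dom b (iota p) ->
  ip gb b (iota p) (covD Db iota xi a b p u) (dmap iota a b p v) =
  ip gb b (iota p) (covD Db iota xi a b p v) (dmap iota a b p u).
Proof.
move=> ap bp; pose y := rep iota a b.
have dy w : differentiable (fun x => 'D_w y x) (coord a p).
  by case: iota_isom => si _; exact: (differentiable2_rep w si).
have E u' v' : ip gb b (iota p) (covD Db iota xi a b p u') (dmap iota a b p v') =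
    - ip gb b (iota p) (xi b p) ('D_u' (fun x => 'D_v' y x) (coord a p) +
         Db b (iota p) (dmap iota a b p u') (dmap iota a b p v')).
  have := derive_ip_along M_mfd Mb_mfd (v := xi b \o coordV a)
    (w := fun x => 'D_v' y x) u' gb_metric Db_LC
    (@continuous_iota p) (differentiable_iota ap bp) ap bp
    (differentiable_xi ap bp) (dy v').
  rewrite /= !(coordK M_mfd ap) -/(covD Db iota xi a b p u').
  have nE : \forall x \near coord a p,
      ip gb b (iota (coordV a x)) (xi b (coordV a x)) ('D_v' y x) = cst 0 x.
    apply: filterS (near_iota ap bp) => x [bx ax xE].
    by rewrite ipC_amb // -(xi_orth v' ax bx) /dmap xE.
  by rewrite (near_eq_derive _ nE) derive_cst => /esym/eqP; rewrite addr_eq0 => /eqP.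
case: (Db_LC) => _ Dsym _.
have Dc := Dsym b (iota p) (dmap iota a b p u) (dmap iota a b p v) bp.
apply: etrans (E u v) _; apply: etrans _ (esym (E v u)).
apply: (congr1 (fun z => - ip gb b (iota p) (xi b p) z)).
apply: add_congr; last exact: Dc.
apply: young_mx (dy v) (dy u).
apply: filterS (near_iota ap bp) => x [bx ax xE].
by rewrite -xE; exact: differentiable_iota.
Qed.

(** Differentiate <X, xi> = |X| cos theta in the direction v: |X| is stationary, and in
<X, D_v xi> only the part |X| sin theta T of X counts.  The factor
|X| sin theta cancels, and the symmetry of the shape operator exchanges v and T. *)
Lemma dtheta_shape a b p v : dom a p -> dom b (iota p) ->
  ip gM a p v (T a p) = 0 ->
  dfun theta a p v =
  ip gb b (iota p) (shape Db iota xi a b p (T a p)) (dmap iota a b p v).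
Proof.
move=> ap bp vT; have s0 := sin_theta_gt0 p; have m0 := normX_gt0 bp.
have ms : normX b p * sin (theta p) != 0 by rewrite mulf_neq0 // gt_eqF.
have Xv : ip gb b (iota p) (X b (iota p)) (dmap iota a b p v) = 0.
  move: vT; rewrite ipC_sub // (ip_T _ ap bp) => /eqP.
  by rewrite mulf_eq0 invr_eq0 (negbTE ms) => /eqP.
have dm := differentiable_normX ap bp.
have dth := differentiable_theta ap.
have D_m : 'D_v (normX b \o coordV a) (coord a p) = 0.
  have nE : \forall x \near coord a p, (X_X b \o coordV a) x =
      (normX b \o coordV a) x * (normX b \o coordV a) x.
    apply: filterS (near_iota ap bp) => x [bx _ _] /=.
    by rewrite -sqr_normX // expr2.
  have := derive_X_X ap bp Xv; rewrite (near_eq_derive _ nE).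
  rewrite deriveM; [|exact: diff_derivable..].
  rewrite /= coordK // -mulr2n => /eqP; rewrite mulrn_eq0 /=.
  rewrite scaler_eq0.
  by rewrite (gt_eqF m0) => /eqP.
have := derive_X_xi v ap bp.
have dcos : differentiable (cos \o (theta \o coordV a)) (coord a p).
  apply: (differentiable_comp1 dth); exact: is_derive_cos.
have nE : \forall x \near coord a p, (X_xi b \o coordV a) x =
    (normX b \o coordV a) x * (cos \o (theta \o coordV a)) x.
  by apply: filterS (near_iota ap bp) => x [bx _ _] /=; rewrite X_xiE.
rewrite (near_eq_derive _ nE).
rewrite deriveM; [|exact: diff_derivable..].
rewrite D_m [_ *: 0]mulr0 addr0 (derive_comp1 v dth (is_derive_cos _)) /=.
rewrite (coordK M_mfd ap).
have -> : X b (iota p) = (normX b p * sin (theta p)) *: dmap iota a b p (T a p)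
    + X_xi b p *: xi b p.
  by rewrite dmap_T // scalerA divff ?scale1r ?subrK // mulf_neq0 // gt_eqF.
rewrite ipDl !ipZl (ipC_amb (xi b p)) // covD_xi_orth // mulr0 addr0.
rewrite (ipC_amb (dmap _ _ _ _ _)) // (covD_xi_sym _ _ ap bp) => E.
rewrite /shape ipNl.
rewrite -/(dfun theta a p v) in E.
apply: (mulfI ms); rewrite mulrN -E -[_ *: _]/(_ * _); ring.
Qed.

Lemma principal_iff_angle :
  principal_direction Db iota xi T <-> angle_constant_orthogonally gM T theta.
Proof.
split=> [pd a p v ap vT|ac a b p ap bp].
  have [b bp] := chart_at Mb_mfd (iota p).
  have [l sE] := pd a b p ap bp.
  rewrite (dtheta_shape ap bp vT) sE ipZl.
  by rewrite ip_iota // ipC_sub // vT mulr0.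
have [_ pg sg _] := gM_metric.
have dy := differentiable_iota ap bp.
pose J := jacobian (rep iota a b) (coord a p).
have dJ v : dmap iota a b p v = v *m J by exact: deriveEjacobian.
have [s sE] : exists s, shape Db iota xi a b p (T a p) = s *m J.
  apply: (orthogonal_normal_tangent (nu := xi b p) (G := gb b (iota p))).
  - move=> v; rewrite -dJ => v0; apply/eqP/negP => /negP /(pg a p v ap).
    by rewrite -(ip_iota _ _ ap bp) v0 ip0l ltxx.
  - exact: xi_unit.
  - by move=> v; rewrite -dJ; exact: xi_orth.
  - by rewrite -[LHS]/(ip gb b (iota p) _ _) ipNl covD_xi_orth // oppr0.
exists (ip gM a p s (T a p)); rewrite sE.
suff sT : s = ip gM a p s (T a p) *: T a p by rewrite {1}sT dJ scalemxAl.
apply: parallel_of_orthogonal.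
- by case: gM_metric => sy _ _ _; exact: (sy a p ap).
- by move=> v v0; exact: pg.
- exact: T_unit.
- move=> v vT; have := ac a p v ap vT; rewrite (dtheta_shape ap bp vT) sE -dJ.
  by rewrite ip_iota.
Qed.

(** * Graphs in a warped product *)

Section graph.
Variables (N : atlas R n) (gN : metric N) (I : set R) (rho : R -> R).
Variables (W : set Mb) (Phi : cylinder N -> Mb) (Psi : Mb -> cylinder N).
Hypotheses (N_mfd : is_manifold N) (gN_metric : is_metric gN).
Hypotheses (rho_smooth : smooth_on I rho) (rho_pos : forall t, I t -> 0 < rho t).
Hypothesis (Phi_isom : open_isometry (warped_metric gN rho) gb
                  [set q : cylinder N | I q.1] W Phi Psi).
Hypothesis (X_warped : forall (e : chart (cylinder N)) c (q : cylinder N),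
       I q.1 -> dom e q -> dom c (Phi q) ->
       X c (Phi q) = dmap Phi e c q (rho q.1 *: partial_t R n)).
Hypothesis (theta_neq : forall p, theta p <> pi / 2%:R).
Variables (U : set N) (F : N -> R).
Hypothesis (F_I : forall x, U x -> I (F x)).
Hypothesis (F_smooth : smooth_fun U F).
Hypothesis (M_graph : range iota = [set Phi (F x, x) | x in U]).
Variable (h : M -> R).
Hypothesis (h_def : forall p, h p = (Psi (iota p)).1).

Definition base_point p : N := (Psi (iota p)).2.
Let pr := base_point.

Lemma graph_point x : U x -> exists p, [/\ iota p = Phi (F x, x), pr p = x & h p = F x].
Proof.
move=> Ux; have : [set Phi (F x, x) | x in U] (Phi (F x, x)) by exists x.
rewrite -M_graph => -[p _ pE]; exists p.
case: Phi_isom => _ _ /(_ (F x, x) (F_I Ux)) [_ PsiE] _ _.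
by rewrite h_def /pr /base_point pE PsiE.
Qed.

Lemma point_graph p : exists x, [/\ U x, iota p = Phi (F x, x), pr p = x & h p = F x].
Proof.
have : range iota (iota p) by exists p.
rewrite M_graph => -[x Ux pE]; exists x.
case: Phi_isom => _ _ /(_ (F x, x) (F_I Ux)) [_ PsiE] _ _.
by rewrite h_def /pr /base_point -pE PsiE.
Qed.

Lemma U_base_point p : U (pr p).
Proof. by have [x [Ux _ -> _]] := point_graph p. Qed.

Lemma height_base_point p : h p = F (pr p).
Proof. by have [x [_ _ -> ->]] := point_graph p. Qed.

Lemma I_height p : I (h p).
Proof. by rewrite height_base_point; exact/F_I/U_base_point. Qed.

Lemma Psi_iota p : Psi (iota p) = (h p, pr p).
Proof. by rewrite h_def /pr /base_point; case: (Psi _). Qed.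

Lemma iota_W p : W (iota p).
Proof.
have [x [Ux pE _ _]] := point_graph p; rewrite pE.
by case: Phi_isom => _ _ /(_ (F x, x) (F_I Ux)) [].
Qed.

Lemma Phi_Psi q : W q -> I (Psi q).1 /\ Phi (Psi q) = q.
Proof. by case: Phi_isom => _ _ _ /(_ q) + _ => /[apply]. Qed.

Lemma cylinder_coordK (b : chart N) (z : cylinder N) : dom b z.2 ->
  coordV (b : chart (cylinder N)) (coord (b : chart (cylinder N)) z) = z.
Proof.
move=> bz; case: z bz => t x /= bx.
by rewrite row_mxKl row_mxKr mxE mulr1n (coordK N_mfd).
Qed.

Lemma lsubmx_partial_t k : (lsubmx (k *: partial_t R n) : 'M[R]_1) 0 0 = k.
Proof.
have -> : lsubmx (k *: partial_t R n) = k *: lsubmx (partial_t R n) by exact: linearZ.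
by rewrite row_mxKl !mxE mulr1n mulr1.
Qed.

Lemma rsubmx_partial_t k : rsubmx (k *: partial_t R n) = 0.
Proof.
have -> : rsubmx (k *: partial_t R n) = k *: rsubmx (partial_t R n) by exact: linearZ.
by rewrite row_mxKr scaler0.
Qed.

Lemma continuous_Psi q : W q -> {for q, continuous Psi}.
Proof. by case: Phi_isom => _ _ _ _ [_ [+ _] _]; exact. Qed.

Lemma continuous_base_point p : {for p, continuous pr}.
Proof.
have c1 : {for p, continuous (Psi \o iota)}.
  by apply: continuous_comp; [exact: continuous_iota|apply: continuous_Psi; exact: iota_W].
apply: (@continuous_comp _ _ _ (Psi \o iota) snd) => //.
exact: cvg_snd.
Qed.

Section at_point.
Variables (a : chart M) (c : chart Mb) (b : chart N) (p : M).
Hypotheses (ap : dom a p) (cp : dom c (iota p)) (bp : dom b (pr p)).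
Let b' : chart (cylinder N) := b.
Let q := Psi (iota p).

Let bq : dom b' q. Proof. by split. Qed.

Let Iq : I q.1. Proof. by rewrite /q -h_def; exact: I_height. Qed.

Let Phi_q : Phi q = iota p. Proof. by have [] := Phi_Psi (iota_W p). Qed.

Lemma differentiable_Psi : differentiable (rep Psi c b') (coord c (iota p)).
Proof.
case: Phi_isom => _ _ _ _ [_ sPsi _].
exact: (differentiable_rep sPsi (iota_W p) cp bq).
Qed.

Lemma differentiable_Phi : differentiable (rep Phi b' c) (coord b' q).
Proof.
case: Phi_isom => _ _ _ _ [sPhi _ _].
apply: (differentiable_rep sPhi Iq bq); rewrite Phi_q; exact: cp.
Qed.

Lemma rep_Phi_Psi : \forall y \near coord c (iota p),
  (rep Phi b' c \o rep Psi c b') y = y.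
Proof.
have W_open : open W by case: Phi_isom.
have nW : \forall z \near iota p, W z /\ dom b (Psi z).2.
  have n1 : \forall z \near iota p, W z.
    by apply: open_nbhs_nbhs; split => //; exact: iota_W.
  have n2 : \forall z \near iota p, dom b (Psi z).2.
    have c2 : {for iota p, continuous (snd \o Psi)}.
      apply: continuous_comp; first by apply: continuous_Psi; exact: iota_W.
      exact: cvg_snd.
    by apply: c2; exact: (near_dom N_mfd bp).
  by apply: filterS2 n1 n2.
apply: filterS (near_coord Mb_mfd cp nW) => y [[Wy by_] cy yE].
rewrite -[LHS]/(coord c (Phi (coordV b' (coord b' (Psi (coordV c y)))))).
by rewrite (cylinder_coordK by_) (Phi_Psi Wy).2 yE.
Qed.

(** Psi inverts Phi near iota p, so the chain rule inverts d Phi. *)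
Lemma dmap_Phi_Psi w : dmap Phi b' c q (dmap Psi c b' (iota p) w) = w.
Proof.
have E := near_eq_derive w rep_Phi_Psi.
rewrite derive_id in E; apply: etrans E.
have rE : rep Psi c b' (coord c (iota p)) = coord b' q.
  by rewrite /rep /= (coordK Mb_mfd cp).
have dPhi := differentiable_Phi; rewrite -rE in dPhi.
by rewrite (derive_comp w differentiable_Psi dPhi) rE.
Qed.

Lemma ip_warped t (u w : 'rV[R]_(1 + n)) :
  ip (warped_metric gN rho) b' t u w =
  lsubmx u 0 0 * lsubmx w 0 0 +
  rho t.1 ^+ 2 * ip gN b t.2 (rsubmx u) (rsubmx w).
Proof.
rewrite /ip /warped_metric -{1}(hsubmxK u) -{1}(hsubmxK w).
rewrite mul_row_block !mulmx0 addr0 add0r mulmx1 tr_row_mx mul_row_col.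
generalize (lsubmx u) (rsubmx u) (lsubmx w) (rsubmx w) => u1 u2 w1 w2.
by rewrite -scalemxAr -scalemxAl !mxE big_ord1 mxE.
Qed.

Lemma ip_amb_split u w :
  ip gb c (iota p) u w =
  ip (warped_metric gN rho) b' q (dmap Psi c b' (iota p) u) (dmap Psi c b' (iota p) w).
Proof.
case: Phi_isom => _ _ _ _ [_ _ pres].
have cq : dom c (Phi q) by rewrite Phi_q.
by rewrite (pres b' c q _ _ Iq bq cq) !dmap_Phi_Psi Phi_q.
Qed.

Lemma ip_X u : ip gb c (iota p) (X c (iota p)) u =
  rho (h p) * lsubmx (dmap Psi c b' (iota p) u) 0 0.
Proof.
case: Phi_isom => _ _ _ _ [_ _ pres].
have cq : dom c (Phi q) by rewrite Phi_q.
rewrite -{1}(dmap_Phi_Psi u); set u' := dmap Psi c b' (iota p) u.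
rewrite -Phi_q.
rewrite (X_warped Iq bq cq) -(pres b' c q _ _ Iq bq cq) ip_warped.
by rewrite lsubmx_partial_t rsubmx_partial_t ip0l !mulr0 addr0 /q -h_def.
Qed.

Lemma X_X_warped : X_X c p = rho (h p) ^+ 2.
Proof.
case: Phi_isom => _ _ _ _ [_ _ pres].
have cq : dom c (Phi q) by rewrite Phi_q.
rewrite /X_X -Phi_q (X_warped Iq bq cq) -(pres b' c q _ _ Iq bq cq) ip_warped.
by rewrite lsubmx_partial_t rsubmx_partial_t ip0l !mulr0 addr0 /q -h_def expr2.
Qed.

Lemma normX_warped : normX c p = rho (h p).
Proof.
rewrite /normX /mnorm -/(X_X c p) X_X_warped sqrtr_sqr ger0_norm //.
exact/ltW/rho_pos/I_height.
Qed.

Let split_rep x := rep Psi c b' (rep iota a c x).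

Let split_rep_diff : differentiable split_rep (coord a p).
Proof.
have rE : rep iota a c (coord a p) = coord c (iota p).
  by rewrite /rep /= (coordK M_mfd ap).
apply: (differentiable_comp (differentiable_iota ap cp)).
by rewrite rE; exact: differentiable_Psi.
Qed.

Let derive_split_rep v : 'D_v split_rep (coord a p) =
  dmap Psi c b' (iota p) (dmap iota a c p v).
Proof.
have rE : rep iota a c (coord a p) = coord c (iota p).
  by rewrite /rep /= (coordK M_mfd ap).
have dPsi := differentiable_Psi; rewrite -rE in dPsi.
have E := derive_comp v (differentiable_iota ap cp) dPsi.
by apply: etrans E _; rewrite rE.
Qed.

Let split_repE : \forall x \near coord a p,
  split_rep x = row_mx (h (coordV a x))%:M (coord b (pr (coordV a x))).
Proof.
apply: filterS (near_iota ap cp) => x [cx ax xE].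
by rewrite /split_rep /rep /= (coordK Mb_mfd cx) Psi_iota.
Qed.

Lemma differentiable_height_at : differentiable (h \o coordV a) (coord a p).
Proof.
have nE : \forall x \near coord a p, split_rep x 0 (lshift n 0) = (h \o coordV a) x.
  by apply: filterS split_repE => x ->; rewrite row_mxEl mxE mulr1n.
by apply: near_eq_differentiable nE _; exact: differentiable_entry.
Qed.

Lemma dfun_height v : dfun h a p v =
  lsubmx (dmap Psi c b' (iota p) (dmap iota a c p v)) 0 0.
Proof.
have nE : \forall x \near coord a p, split_rep x 0 (lshift n 0) = (h \o coordV a) x.
  by apply: filterS split_repE => x ->; rewrite row_mxEl mxE mulr1n.
rewrite /dfun -(near_eq_derive v nE) mxE.
apply: etrans (esym (derive_entry v 0 (lshift n 0) split_rep_diff)) _.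
by have E := derive_split_rep v; rewrite E.
Qed.

Let rep_prE i : \forall x \near coord a p,
  split_rep x 0 (rshift 1 i) = (rep pr a b x) 0 i.
Proof. by apply: filterS split_repE => x ->; rewrite row_mxEr. Qed.

Lemma differentiable_base_point : differentiable (rep pr a b) (coord a p).
Proof.
apply: differentiable_mx => i j; rewrite ord1.
by apply: near_eq_differentiable (rep_prE j) _; exact: differentiable_entry.
Qed.

Lemma dmap_base_point v : dmap pr a b p v =
  rsubmx (dmap Psi c b' (iota p) (dmap iota a c p v)).
Proof.
apply/rowP => j; rewrite /dmap (derive_entry v 0 j differentiable_base_point).
rewrite -(near_eq_derive v (rep_prE j)) mxE.
apply: etrans (esym (derive_entry v 0 (rshift 1 j) split_rep_diff)) _.
by have E := derive_split_rep v; rewrite E.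
Qed.

(** By [ip_X] and [dfun_height], dh = <X, _> / rho, while |X| = rho and
|X| sin theta T is the tangential part of X. *)
Lemma dfun_height_T_at v :
  dfun h a p v = sin (theta p) * ip gM a p (T a p) v.
Proof.
rewrite (ip_T _ ap cp) normX_warped ip_X -dfun_height.
have r0 := rho_pos (I_height p); have s0 := sin_theta_gt0 p.
by field; rewrite !gt_eqF.
Qed.

Lemma ip_sub_split v w : ip gM a p v w =
  dfun h a p v * dfun h a p w +
  rho (h p) ^+ 2 * ip gN b (pr p) (dmap pr a b p v) (dmap pr a b p w).
Proof.
rewrite -(ip_iota _ _ ap cp) ip_amb_split ip_warped !dfun_height !dmap_base_point.
by rewrite /q -h_def.
Qed.

Lemma dfun_height_F v : dfun h a p v = dfun F b (pr p) (dmap pr a b p v).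
Proof.
have rE : rep pr a b (coord a p) = coord b (pr p) by rewrite /rep /= (coordK M_mfd ap).
have dF : differentiable (F \o coordV b) (rep pr a b (coord a p)).
  by rewrite rE; exact: (differentiable_fun F_smooth (U_base_point p) bp).
have nE : \forall x \near coord a p,
    ((F \o coordV b) \o rep pr a b) x = (h \o coordV a) x.
  apply: filterS (near_dom_along M_mfd N_mfd (@continuous_base_point p) ap bp).
  by move=> x [bx _ _]; rewrite /rep /= (coordK N_mfd bx) height_base_point.
rewrite /dfun -(near_eq_derive v nE).
have E := derive_comp v differentiable_base_point dF.
by apply: etrans E _; rewrite rE.
Qed.

(** A vector in the kernel of d pr has dh = dF o d pr = 0 too, hence norm 0 by
[ip_sub_split]; and M and N have the same dimension. *)
Lemma dmap_base_point_surj w : exists v, dmap pr a b p v = w.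
Proof.
pose J := jacobian (rep pr a b) (coord a p).
have dJ v : dmap pr a b p v = v *m J.
  exact: deriveEjacobian differentiable_base_point.
have Ju : J \in unitmx.
  rewrite -row_free_unit; apply: inj_row_free => v; rewrite -dJ => v0.
  case: gM_metric => _ pg _ _; apply/eqP/negP => /negP /(pg a p v ap).
  rewrite ip_sub_split dfun_height_F v0 ip0l mulr0 addr0.
  have -> : dfun F b (pr p) 0 = 0 by exact: derive0.
  by rewrite mul0r ltxx.
by exists (w *m invmx J); rewrite dJ mulmxKV.
Qed.

Lemma cos_theta_neq0_at : cos (theta p) != 0.
Proof.
apply/eqP => c0; apply: (@theta_neq p).
have [_ t0 tpi _] := theta_angle cp.
rewrite -[LHS]cosK ?in_itv /= ?ltW // c0 acos0 //.
Qed.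

(** Put v1 = sin theta T, the gradient of h.  Then [ip_sub_split] reads
dh(v) = <v1, v> = sin^2 theta dh(v) + rho^2 gN(d pr v1, d pr v), that is,
cos^2 theta dF(w) = rho^2 gN(d pr v1, w) for w = d pr v, which is an arbitrary
vector. *)
Lemma grad_F : grad gN F b (pr p) =
  (rho (h p) ^+ 2 / cos (theta p) ^+ 2 * sin (theta p)) *: dmap pr a b p (T a p).
Proof.
have r0 := rho_pos (I_height p); have c0 := cos_theta_neq0_at.
apply: gradE => // w; have [v <-] := dmap_base_point_surj w.
rewrite ipZl -dfun_height_F.
have := ip_sub_split (T a p) v; rewrite (dfun_height_T_at (T a p)) T_unit // mulr1.
set g := ip gN _ _ _ _; set s := sin _; set k := cos _; move=> E.
have hE : dfun h a p v = s * (s * dfun h a p v + rho (h p) ^+ 2 * g).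
  by rewrite -E dfun_height_T_at.
have k2 : k ^+ 2 = 1 - s ^+ 2 by rewrite /k cos2sin2.
have -> : rho (h p) ^+ 2 / k ^+ 2 * s * g = (s * (rho (h p) ^+ 2 * g)) / k ^+ 2.
  by ring.
apply: (canRL (mulfK _)); first by rewrite expf_neq0.
by rewrite k2; lra.
Qed.

Lemma sqr_grad_norm_F : (grad_norm gN F b (pr p) * cos (theta p)) ^+ 2 =
  (rho (h p) * sin (theta p)) ^+ 2.
Proof.
have c0 := cos_theta_neq0_at.
have gg : ip gN b (pr p) (grad gN F b (pr p)) (grad gN F b (pr p)) =
    (rho (h p) * sin (theta p) / cos (theta p)) ^+ 2.
  rewrite ip_grad //; last exact: (differentiable_fun F_smooth (U_base_point p) bp).
  rewrite grad_F.
  have -> : forall k w, dfun F b (pr p) (k *: w) = k * dfun F b (pr p) w.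
    move=> k w; apply: derive_scale.
    exact: (differentiable_fun F_smooth (U_base_point p) bp).
  rewrite -dfun_height_F dfun_height_T_at T_unit // mulr1.
  by field.
rewrite exprMn /grad_norm /mnorm sqr_sqrtr gg ?sqr_ge0 //.
by field.
Qed.

(** The graph is nowhere tangent to the slices, as sin theta does not vanish; this
makes the norm of the gradient differentiable. *)
Lemma grad_norm_F_gt0 : 0 < grad_norm gN F b (pr p).
Proof.
rewrite lt_neqAle sqrtr_ge0 andbT eq_sym; apply/eqP => G0.
have := sqr_grad_norm_F; rewrite G0 mul0r expr0n /= => /esym/eqP.
have r0 := rho_pos (I_height p); have s0 := sin_theta_gt0 p.
by rewrite expf_eq0 /= mulf_eq0 (gt_eqF r0) (gt_eqF s0).
Qed.

Lemma differentiable_grad_norm_F :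
  differentiable (grad_norm gN F b \o coordV b) (coord b (pr p)).
Proof.
have nb := near_coord N_mfd bp (near_dom N_mfd bp).
have dG : differentiable (gN b \o coordV b) (coord b (pr p)).
  by case: gN_metric => _ _ _ sg; apply: (smooth_on_differentiable (sg b)); exists (pr p).
have dgrad : differentiable (grad gN F b \o coordV b) (coord b (pr p)).
  rewrite /grad; apply: differentiable_mulmx; last first.
    apply: differentiable_invmx => //.
    by apply: filterS nb => y [by_ _ _]; exact: metric_unit.
  apply: differentiable_mx => i j; under eq_fun do rewrite mxE.
  have nE : \forall y \near coord b (pr p),
      'D_(delta_mx 0 j) (F \o coordV b) y = dfun F b (coordV b y) (delta_mx 0 j).
    by apply: filterS nb => y [_ _ yE]; rewrite /dfun yE.
  apply: near_eq_differentiable nE _.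
  apply: (smooth_on_differentiable2 (F_smooth b)); exists (pr p) => //.
  by split => //; exact: U_base_point.
apply: differentiable_sqrt; first exact: differentiable_gram.
by rewrite /= (coordK N_mfd bp) -sqrtr_gt0; exact: grad_norm_F_gt0.
Qed.

End at_point.

Section derivative.
Variables (a : chart M) (c : chart Mb) (b : chart N) (p : M).
Hypotheses (ap : dom a p) (cp : dom c (iota p)) (bp : dom b (pr p)).

(** The function |grad F| is differentiated on M, after composition with pr, so that
no smooth inverse of pr is called for. *)
Lemma derive_grad_norm_F v : dfun h a p v = 0 ->
  dfun (grad_norm gN F b) b (pr p) (dmap pr a b p v) = 0 <-> dfun theta a p v = 0.
Proof.
move=> hv; pose G := grad_norm gN F b.
have rE : rep pr a b (coord a p) = coord b (pr p) by rewrite /rep /= (coordK M_mfd ap).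
have npr := near_dom_along M_mfd N_mfd (@continuous_base_point p) ap bp.
have nio := near_iota ap cp.
have dpr := differentiable_base_point ap cp bp.
have dG : differentiable (G \o coordV b) (rep pr a b (coord a p)).
  by rewrite rE; exact: (differentiable_grad_norm_F ap cp bp).
pose Gp := (G \o coordV b) \o rep pr a b.
have dGp : differentiable Gp (coord a p) by exact: differentiable_comp.
have GpE : 'D_v Gp (coord a p) = dfun G b (pr p) (dmap pr a b p v).
  have E := derive_comp v dpr dG.
  by apply: etrans E _; rewrite rE.
have dth := differentiable_theta ap.
have dcos := differentiable_comp1 dth (is_derive_cos _).
have dsin := differentiable_comp1 dth (is_derive_sin _).
have Dcos := derive_comp1 v dth (is_derive_cos _).
have Dsin := derive_comp1 v dth (is_derive_sin _).
have dh := differentiable_height_at ap cp bp.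
have drho : differentiable rho ((h \o coordV a) (coord a p)).
  apply: (smooth_on_differentiable rho_smooth).
  by rewrite /= (coordK M_mfd ap); exact: I_height.
pose rh := rho \o (h \o coordV a).
have drh : differentiable rh (coord a p) by exact: differentiable_comp.
have Drh : 'D_v rh (coord a p) = 0.
  have E := derive_comp v dh drho; apply: etrans E _.
  rewrite -[X in 'D_X _ _]/(dfun h a p v) hv; exact: derive0.
pose lhs := Gp * (cos \o (theta \o coordV a)).
pose rhs := rh * (sin \o (theta \o coordV a)).
have dl : differentiable lhs (coord a p) by exact: differentiableM.
have dr : differentiable rhs (coord a p) by exact: differentiableM.
have nE : \forall x \near coord a p, (lhs ^+ 2) x = (rhs ^+ 2) x.
  apply: filterS2 npr nio => x [bx ax xE] [cx _ _].
  rewrite -[LHS]/((G (coordV b (coord b (pr (coordV a x)))) *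
                   cos (theta (coordV a x))) ^+ 2) (coordK N_mfd bx).
  exact: (sqr_grad_norm_F ax cx bx).
have := near_eq_derive v nE.
rewrite (deriveX _ (diff_derivable dl)) (deriveX _ (diff_derivable dr)).
rewrite (deriveM (diff_derivable dGp) (diff_derivable dcos)).
rewrite (deriveM (diff_derivable drh) (diff_derivable dsin)).
rewrite GpE Drh Dcos Dsin.
have lE : lhs (coord a p) = G (pr p) * cos (theta p).
  rewrite -[LHS]/(G (coordV b (coord b (pr (coordV a (coord a p))))) *
                  cos (theta (coordV a (coord a p)))).
  by rewrite (coordK M_mfd ap) (coordK N_mfd bp).
have rhE : rhs (coord a p) = rho (h p) * sin (theta p).
  rewrite -[LHS]/(rho (h (coordV a (coord a p))) *
                  sin (theta (coordV a (coord a p)))).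
  by rewrite (coordK M_mfd ap).
have GE : Gp (coord a p) = G (pr p).
  by rewrite /Gp /rep /= (coordK M_mfd ap) (coordK N_mfd bp).
rewrite lE rhE GE /rh /= (coordK M_mfd ap) -/(dfun theta a p v).
have G0 : 0 < G (pr p) := grad_norm_F_gt0 ap cp bp.
have r0 := rho_pos (I_height p); have s0 := sin_theta_gt0 p.
have k0 := cos_theta_neq0_at cp.
rewrite !expr1; exact: product_rule_balance.
Qed.

End derivative.

Lemma angle_iff_grad_norm_graph :
  angle_constant_orthogonally gM T theta <-> grad_norm_constant_on_levels gN U F.
Proof.
split=> [H b x w Ux bx Fw|H a p v ap vT].
  have [p [_ px _]] := graph_point Ux; rewrite -px in bx Fw *.
  have [a ap] := chart_at M_mfd p; have [c cp] := chart_at Mb_mfd (iota p).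
  have [v vw] := dmap_base_point_surj ap cp bx w.
  rewrite -vw in Fw *.
  have hv : dfun h a p v = 0 by rewrite (dfun_height_F ap cp bx).
  apply/(derive_grad_norm_F ap cp bx hv)/H => //.
  move: hv; rewrite (dfun_height_T_at ap cp bx) ipC_sub // => /eqP.
  by rewrite mulf_eq0 (gt_eqF (sin_theta_gt0 p)) => /eqP.
have [c cp] := chart_at Mb_mfd (iota p); have [b bp] := chart_at N_mfd (pr p).
have hv : dfun h a p v = 0.
  by rewrite (dfun_height_T_at ap cp bp) ipC_sub // vT mulr0.
apply/(derive_grad_norm_F ap cp bp hv)/H => //; first exact: U_base_point.
by rewrite -(dfun_height_F ap cp bp).
Qed.

Lemma differentiable_height a p : dom a p ->
  differentiable (h \o coordV a) (coord a p).
Proof.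
move=> ap; have [c cp] := chart_at Mb_mfd (iota p).
have [b bp] := chart_at N_mfd (pr p).
exact: (differentiable_height_at ap cp bp).
Qed.

Lemma dfun_height_T a p v : dom a p ->
  dfun h a p v = sin (theta p) * ip gM a p (T a p) v.
Proof.
move=> ap; have [c cp] := chart_at Mb_mfd (iota p).
have [b bp] := chart_at N_mfd (pr p).
exact: (dfun_height_T_at ap cp bp).
Qed.

Lemma cos_theta_neq0 p : cos (theta p) != 0.
Proof.
have [c cp] := chart_at Mb_mfd (iota p); exact: (cos_theta_neq0_at cp).
Qed.

End graph.
End hypersurface.

Theorem theorem5 (R : realType) (n : nat)
    (* the ambient Riemannian manifold, and X *)
    (Mb : atlas R n.+1) (gb : metric Mb) (Db : connection Mb) (X : vfield Mb)
    (Mb_mfd : is_manifold Mb) (gb_metric : is_metric gb)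
    (Db_LC : levi_civita gb Db)
    (X_field : is_vfield X) (X_conf : closed_conformal Db X)
    (X_nonnull : exists a p, dom a p /\ X a p != 0)
    (* the hypersurface, with its induced metric and its unit normal field *)
    (M : atlas R n) (gM : metric M) (DM : connection M)
    (iota : M -> Mb) (xi : field_along iota)
    (M_mfd : is_manifold M) (gM_metric : is_metric gM)
    (DM_LC : levi_civita gM DM)
    (iota_isom : isometric_immersion gM gb iota)
    (xi_normal : unit_normal gb iota xi)
    (theta : M -> R) (theta_angle : angle_in_0pi gb iota xi X theta)
    (T : vfield M) (T_def : unit_tangential gb iota xi X T) :
  (principal_direction Db iota xi T <-> angle_constant_orthogonally gM T theta)
  /\
  forall
    (* the open subset W, isometric to the warped product of I and N *)
    (N : atlas R n) (gN : metric N) (I : set R) (rho : R -> R)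
    (W : set Mb) (Phi : cylinder N -> Mb) (Psi : Mb -> cylinder N)
    (N_mfd : is_manifold N) (gN_metric : is_metric gN)
    (I_open : open I) (I_itv : is_interval I)
    (rho_smooth : smooth_on I rho) (rho_pos : forall t, I t -> 0 < rho t)
    (Phi_isom : open_isometry (warped_metric gN rho) gb
                  [set q : cylinder N | I q.1] W Phi Psi)
    (X_warped : forall b c (q : cylinder N), I q.1 -> dom b q ->
       dom c (Phi q) ->
       X c (Phi q) = dmap Phi b c q (rho q.1 *: partial_t R n))
    (theta_neq : forall p, theta p <> pi / 2%:R)
    (* M as the graph of F *)
    (U : set N) (F : N -> R)
    (U_open : open U) (F_I : forall x, U x -> I (F x))
    (F_smooth : smooth_fun U F)
    (iota_inj : injective iota)
    (M_graph : range iota = [set Phi (F x, x) | x in U])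
    (* the height function *)
    (h : M -> R) (h_def : forall p, h p = (Psi (iota p)).1),
  [/\ principal_direction Db iota xi T <-> integral_curves_geodesic DM T,
      principal_direction Db iota xi T <-> grad_norm_constant_on_levels gM setT h &
      principal_direction Db iota xi T <-> grad_norm_constant_on_levels gN U F].
Proof.
have pd_angle := principal_iff_angle Mb_mfd gb_metric Db_LC X_field X_conf M_mfd
  gM_metric iota_isom xi_normal theta_angle T_def.
split=> // N gN I rho W Phi Psi N_mfd gN_metric _ _ rho_smooth rho_pos Phi_isom
  X_warped theta_neq U F _ F_I F_smooth _ M_graph h h_def.
have T_field : is_vfield T by case: T_def.
have T1 := T_unit Mb_mfd gb_metric M_mfd iota_isom xi_normal theta_angle T_def.
have sin0 := sin_theta_gt0 Mb_mfd theta_angle.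
have cos0 := cos_theta_neq0 Mb_mfd theta_angle theta_neq.
have dtheta := differentiable_theta Mb_mfd gb_metric X_field M_mfd
  iota_isom xi_normal theta_angle.
have dh := differentiable_height Mb_mfd M_mfd iota_isom N_mfd Phi_isom F_I
  M_graph h_def.
have dhE := dfun_height_T Mb_mfd gb_metric M_mfd iota_isom xi_normal theta_angle
  T_def N_mfd rho_pos Phi_isom X_warped F_I M_graph h_def.
split; apply: (iff_trans pd_angle).
- apply: iff_trans (iff_sym (geodesics_iff_acceleration M_mfd T_field DM)).
  exact: (angle_iff_acceleration M_mfd gM_metric DM_LC T_field T1 dtheta sin0
    cos0 dh dhE).
- exact: (angle_iff_grad_norm_height M_mfd gM_metric T1 dtheta sin0 cos0 dhE).
- exact: (angle_iff_grad_norm_graph Mb_mfd gb_metric X_field M_mfd gM_metric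
    iota_isom xi_normal theta_angle T_def N_mfd gN_metric rho_smooth rho_pos
    Phi_isom X_warped theta_neq F_I F_smooth M_graph h_def).
Qed.
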